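(* Let $n\geq 1$. For every particular integer $r\geq 3$, the PPZ ($r$-spin) relations between the generators $\psi_1,\dots,\psi_n$, $\kappa_1$, $\delta^0_J$ ($J\subset\{1,\dots,n\}$, $|J|\geq 2$) and $\delta_{\rm nonsep}$ of the group $H^2(\overline{\mathcal M}_{1,n},\mathbb{Q})$ generate the set of relations $$12\psi_i=\delta_{\rm nonsep}+12\sum_{\substack{J\subset\{1,\dots,n\},\ i\in J\\ |J|\geq 2}}\delta^0_J\quad (i=1,\dots,n),\qquad \kappa_1=\sum_{i=1}^n\psi_i-\sum_{\substack{J\subset\{1,\dots,n\}\\ |J|\geq 2}}\delta^0_J.$$
   Context: **Classes.** $\overline{\mathcal M}_{g,n}$ is the Deligne–Mumford moduli space of stable genus $g$ curves with $n$ markings; cohomology has $\mathbb{Q}$-coefficients; $RH^*\subset H^*$ is the tautological subring (the smallest system of $\mathbb{Q}$-subalgebras closed under push-forward along forgetful and gluing maps). $\psi_i=c_1(\mathbb{L}_i)$ with $\mathbb{L}_i$ the cotangent line at the $i$-th marking, and $\kappa_j=\pi_*(\psi_{n+1}^{j+1})$ for $\pi:\overline{\mathcal M}_{g,n+1}\to\overline{\mathcal M}_{g,n}$ forgetting the last marking. In genus $1$: $\delta^0_J$ is the class of the boundary divisor whose generic curve has a genus $0$ component carrying exactly the markings in $J$, attached at one node to a genus $1$ component carrying the other markings; $\delta_{\rm nonsep}$ is the class of the divisor whose generic curve is irreducible with one nonseparating node. Divisor classes are taken in the orbifold sense. **PPZ ($r$-spin) relations.** Fix $r\geq3$, integers $0\leq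 a_1,\dots,a_n\leq r-2$ and an auxiliary variable $\phi$. Let $V$ have basis $\widetilde e_0,\dots,\widetilde e_{r-2}$, and put $\eta^{ij}=\phi^{\frac{r-2}{r-1}}$ if $i+j=r-2$ and $0$ otherwise. Let $$\omega_{g,n}(\widetilde e_{b_1}\otimes\cdots\otimes\widetilde e_{b_n})=\phi^{(g-1)\frac{r-2}{r-1}}(r-1)^g$$ if $r-1$ divides $g-1-\sum b_i$, and $0$ otherwise. Let $P_0(r,a)=1$ and for $m\geq1$ $$P_m(r,a)=\tfrac12\sum_{b=1}^a(2mr-r-2b)P_{m-1}(r,b-1)-\tfrac{1}{4mr(r-1)}\sum_{b=1}^{r-2}(r-1-b)(2mr-b)(2mr-r-2b)P_{m-1}(r,b-1).$$ Put $(R_m^{-1})^b_a=[r(r-1)\phi^{r/(r-1)}]^{-m}P_m(r,a)$ if $b+m\equiv a \pmod{r-1}$, and $0$ otherwise ($0\le a,b\le r-2$). For $k\geq0$ and a stable graph $\Gamma$ of genus $g$ with $n+k$ legs, put: - $\omega_{g(v),n(v)}$ at each vertex $v$ of genus $g(v)$ and valence $n(v)$; - $\phi^{a_i/(r-1)}\sum_{m\geq0}\sum_b(R_m^{-1})^b_{a_i}\psi_i^m\,\widetilde e_b$ at leg $i$ for $1\leq i\leq n$; - $-\sum_{m\geq1}\sum_b(R_m^{-1})^b_0\,\psi_{n+i}^{m+1}\widetilde e_b$ at leg $n+i$ for $1\leq i\leq k$; - at each edge, with $\psi',\psi''$ the $\psi$-classes on the two branches of the node, $$\frac{\eta^{i'i''}-\sum_{m',m''\geq0}(R^{-1}_{m'})^{i'}_{j'}\eta^{j'j''}(R^{-1}_{m''})^{i''}_{j''}(\psi')^{m'}(\psi'')^{m''}}{\psi'+\psi''}\,\widetilde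 e_{i'}\otimes\widetilde e_{i''}$$ (summation over repeated indices). Contract all tensors assigned to vertices, legs and edges, divide by $|\mathrm{Aut}\,\Gamma|$, and sum over all $\Gamma$. Let $T_k$ be the coefficient of $\phi^d$ in the resulting expression in decorated stable graphs of $\overline{\mathcal M}_{g,n+k}$, and set $$T(g,n,r,a_1,\dots,a_n,d)=r^{g-1}\sum_{k\geq0}\frac{1}{k!}\pi^{(k)}_*T_k,$$ where $\pi^{(k)}:\overline{\mathcal M}_{g,n+k}\to\overline{\mathcal M}_{g,n}$ forgets the last $k$ markings. The complex degree $D$ of this expression is determined by $d(r-1)=\sum a_i+(g-1)(r-2)-rD$. The PPZ ($r$-spin) relations for the given $r$ are the relations $T(g,n,r,a_1,\dots,a_n,d)=0$ in $RH^{2D}(\overline{\mathcal M}_{g,n},\mathbb{Q})$ with $d<0$, equivalently $D>\frac{(r-2)(g-1)+\sum a_i}{r}$. For $g=1$ and $D=1$ each of them is a linear relation between the generators listed in the claim.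
   Formalization: ''Generate'' here allows linear combinations and also multiplying a relation on the space with n+1 markings by psi_{n+1} and pushing forward along the map forgetting it; linear combinations alone fail, as for given r only n PPZ relations are nonzero, while n+1 independent ones are listed. *)

(* Defs.v *)
From mathcomp Require Import all_boot all_order all_algebra all_fingroup.

Set Implicit Arguments.
Unset Strict Implicit.
Unset Printing Implicit Defensive.

Import Order.TTheory GRing.Theory Num.Theory.

Local Open Scope ring_scope.

(** * Stable graphs

    A graph with vertex set ['I_v], edge set ['I_e] and legs ['I_n]: the genus
    of each vertex, the vertex carrying each leg, and the vertex carrying each
    half-edge.  The half-edges of the edge [j] are [(j, false)] and
    [(j, true)].  In a graph of genus [g] every vertex has genus at most [g]. *)
Definition lgraph (g n v e : nat) : finType :=
  ({ffun 'I_v -> 'I_g.+1} * {ffun 'I_n -> 'I_v}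
   * {ffun 'I_e * bool -> 'I_v})%type.

Section Graphs.
Variables g n v e : nat.
Implicit Type G : lgraph g n v e.

Definition vgenus G (u : 'I_v) : nat := G.1.1 u.
Definition leg G (i : 'I_n) : 'I_v := G.1.2 i.
Definition half_vertex G (h : 'I_e * bool) : 'I_v := G.2 h.

Definition opposite (h : 'I_e * bool) : 'I_e * bool := (h.1, ~~ h.2).

Definition valence G (u : 'I_v) : nat :=
  (#|[set i | leg G i == u]| + #|[set h | half_vertex G h == u]|)%N.

Definition adjacent G : rel 'I_v :=
  [rel u w | [exists h, (half_vertex G h == u) && (half_vertex G (opposite h) == w)]].

Definition is_stable G : bool :=
  [&& (0 < v)%N,
      [forall u, forall w, connect (adjacent G) u w],
      (\sum_u vgenus G u + e + 1 == g + v)%N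
    & [forall u, (2 < 2 * vgenus G u + valence G u)%N]].

(** Isomorphisms may permute the vertices, and the half-edges compatibly with
    their pairing into edges; they fix every leg. *)
Definition relabelings : {set {perm 'I_v} * {perm 'I_e * bool}} :=
  [set s : {perm 'I_v} * {perm 'I_e * bool} |
    [forall h, s.2 (opposite h) == opposite (s.2 h)]].

Definition relabel (s : {perm 'I_v} * {perm 'I_e * bool}) G : lgraph g n v e :=
  ([ffun u => G.1.1 ((s.1^-1)%g u)],
   [ffun i => s.1 (leg G i)],
   [ffun h => s.1 (half_vertex G ((s.2^-1)%g h))]).

Definition iso_class G : {set lgraph g n v e} :=
  [set relabel s G | s in relabelings].

Definition graph_aut G : {set {perm 'I_v} * {perm 'I_e * bool}} :=
  [set s in relabelings | relabel s G == G].

End Graphs.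

(** Deletion of the last [k] legs, without stabilisation. *)
Definition forget_legs (g n k v e : nat) (G : lgraph g (n + k) v e) :
    lgraph g n v e :=
  (G.1.1, [ffun i => leg G (lshift k i)], G.2).

(** A decorated stable graph with [n] legs: exponents of the psi classes at the
    legs and at the half-edges, and at each vertex a list [:: j1; ..; jl]
    standing for the monomial kappa_j1 ... kappa_jl.  It denotes the
    push-forward of the decoration under the gluing map of the graph. *)
Record decgraph (n : nat) : Type := DecGraph {
  dg_genus : nat;
  dg_nvert : nat;
  dg_nedge : nat;
  dg_graph : lgraph dg_genus n dg_nvert dg_nedge;
  dg_psi_leg : 'I_n -> nat;
  dg_psi_half : 'I_dg_nedge * bool -> nat;
  dg_kappa : 'I_dg_nvert -> seq nat
}.
Arguments dg_psi_leg {n} _ _.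
Arguments dg_psi_half {n} _ _.
Arguments dg_kappa {n} _ _.

Definition codim n (X : decgraph n) : nat :=
  (dg_nedge X + \sum_i dg_psi_leg X i + \sum_h dg_psi_half X h
   + \sum_u sumn (dg_kappa X u))%N.

(** * The tensors of the PPZ formula

    Every component of every tensor is a rational multiple of one power
    phi^(x/(r-1)) with [x] an integer.  The functions below give the rational
    factor; the exponents [x] are collected in [phi_exponent].  The basis
    e~_0, ..., e~_(r-2) is indexed by ['I_r.-1]. *)
Section PPZ.
Variable r : nat.

Fixpoint ppzP (m a : nat) : rat :=
  match m with
  | 0 => 1
  | m'.+1 =>
      let M : rat := (m'.+1)%:R in
      let R : rat := r%:R in
      2%:R^-1 * (\sum_(1 <= b < a.+1)
                   (2%:R * M * R - R - 2%:R * b%:R) * ppzP m' b.-1)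
      - (4%:R * M * R * (R - 1))^-1
        * (\sum_(1 <= b < r.-1)
             (R - 1 - b%:R) * (2%:R * M * R - b%:R)
             * (2%:R * M * R - R - 2%:R * b%:R) * ppzP m' b.-1)
  end.

(** phi-exponent r - 2 *)
Definition eta (i j : 'I_r.-1) : rat := ((i + j)%N == (r - 2)%N)%:R.

(** (R_m^{-1})^b_a; phi-exponent - r m *)
Definition Rinv (m : nat) (b a : nat) : rat :=
  if b + m == a %[mod r.-1]
  then ((r%:R * (r%:R - 1)) ^+ m)^-1 * ppzP m a else 0.

(** omega of genus [h] on basis vectors with indices of sum [s];
    phi-exponent (h - 1)(r - 2) *)
Definition omega (h s : nat) : rat :=
  if ((r.-1)%:Z %| h%:Z - 1 - s%:Z)%Z then (r%:R - 1) ^+ h else 0.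

(** Coefficient of psi'^m1 psi''^m2 e~_i1 (x) e~_i2 in the numerator of the edge
    term; phi-exponent (r - 2) - r (m1 + m2). *)
Definition edge_num (m1 m2 : nat) (i1 i2 : 'I_r.-1) : rat :=
  ((m1 == 0%N) && (m2 == 0%N))%:R * eta i1 i2
  - \sum_(j1 : 'I_r.-1) \sum_(j2 : 'I_r.-1)
      Rinv m1 i1 j1 * eta j1 j2 * Rinv m2 i2 j2.

(** Coefficient of psi'^p psi''^q in the quotient by psi' + psi''; it has
    phi-exponent (r - 2) - r (p + q + 1).  If E is the quotient and N the
    numerator, then E_(p,q) = N_(p+1,q) - E_(p+1,q-1), and this recursion is
    solved here. *)
Definition edge_coef (p q : nat) (i1 i2 : 'I_r.-1) : rat :=
  \sum_(l < q.+1) (-1) ^+ l * edge_num (p + 1 + l) (q - l) i1 i2.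

Section Contribution.
Variables (g n k D v e : nat) (a : 'I_n -> 'I_r.-1).
Variable G : lgraph g (n + k) v e.

(** [m] records the indices m of the leg series (so that the leg [n + i]
    carries the (m + 1)-st power of psi), [q] the exponents of psi at the
    half-edges. *)
Variables (m : {ffun 'I_(n + k) -> 'I_D.+1})
          (q : {ffun 'I_e * bool -> 'I_D.+1}).

(** (r - 1) times the exponent of phi. *)
Definition phi_exponent : int :=
  \sum_u ((vgenus G u)%:Z - 1) * (r%:Z - 2)
  + \sum_i (a i)%:Z - r%:Z * \sum_i (m i)%:Z
  + \sum_(j < e) (r%:Z - 2
       - r%:Z * ((q (j, false))%:Z + (q (j, true))%:Z + 1)).

(** The contraction; [b] and [c] run over the basis indices at the legs and at
    the half-edges. *)
Definition contraction : rat :=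
  \sum_(b : {ffun 'I_(n + k) -> 'I_r.-1})
  \sum_(c : {ffun 'I_e * bool -> 'I_r.-1})
    (\prod_u omega (vgenus G u)
        (\sum_(i | leg G i == u) b i + \sum_(h | half_vertex G h == u) c h)%N)
    * (\prod_(i < n) Rinv (m (lshift k i)) (b (lshift k i)) (a i))
    * (\prod_(i < k) (if (0 < m (rshift n i))%N
                      then - Rinv (m (rshift n i)) (b (rshift n i)) 0 else 0))
    * (\prod_(j < e) edge_coef (q (j, false)) (q (j, true))
                               (c (j, false)) (c (j, true))).

(** Linear extension to the rational vector space [V] of a map [cl] on
    decorated graphs. *)
Variables (V : lmodType rat) (cl : decgraph n -> V).

(** Image under [cl] of the push-forward along the map forgetting the last [k]
    markings of the graph [G] decorated by the powers psi^m at the first [n]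
    legs, psi^(m+1) at the last [k] legs and psi^q at the half-edges.  At a
    single vertex this is the formula
      pi_* (prod_i psi_i^(m_i) prod_j psi_(n+j)^(m_(n+j) + 1))
        = prod_i psi_i^(m_i) sum_(s in S_k) prod_(c cycle of s)
            kappa_(sum of the m_(n+j) for j in c);
    at several vertices [s] runs over the permutations preserving the vertices.
    If a vertex becomes unstable, the decoration vanishes for dimension
    reasons. *)
Definition push_forget : V :=
  if is_stable (forget_legs G) then
    \sum_(s : {perm 'I_k} |
           [forall i, leg G (rshift n (s i)) == leg G (rshift n i)])
      cl (DecGraph (forget_legs G)
            (fun i => m (lshift k i) : nat)
            (fun h => q h : nat)
            (fun u => [seq (\sum_(i in C) m (rshift n i))%N
                      | C : {set 'I_k} <- enum (porbits s)
                      & [forall i in C, leg G (rshift n i) == u]]))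
  else 0.

End Contribution.

(** The class T(g, n, r, a_1, ..., a_n, d), the generators of the formal space
    of decorated stable graphs being sent to [V] by [cl].  Here [D] is the
    degree determined by d (r - 1) = sum a_i + (g - 1)(r - 2) - r D; a
    decoration has phi-exponent d (r - 1) only if its push-forward has degree
    [D].  Hence the sums over [k] and over the exponents of the psi classes can
    be stopped at [D].  The bounds on [v] and [e] hold for every stable graph.
    The sum over isomorphism classes is written as a sum over graphs divided by
    the size of the isomorphism class. *)
Definition ppz (g n D : nat) (a : 'I_n -> 'I_r.-1) (d : int)
    (V : lmodType rat) (cl : decgraph n -> V) : V :=
  (r%:R : rat) ^ (g%:Z - 1) *:
  \sum_(k < D.+1) ((k`!)%:R : rat)^-1 *:
  \sum_(v < 2 * g + n + k) \sum_(e < 3 * g + n + k)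
  \sum_(G : lgraph g (n + k) v e | is_stable G)
    ((#|iso_class G|%:R * #|graph_aut G|%:R) : rat)^-1 *:
  \sum_(m : {ffun 'I_(n + k) -> 'I_D.+1})
  \sum_(q : {ffun 'I_e * bool -> 'I_D.+1} |
          phi_exponent a G m q == d * (r%:Z - 1))
    contraction a G m q *: push_forget G m q cl.

End PPZ.

(** * Divisor classes in genus 1

    [divspace n] is the rational vector space freely spanned by symbols for
    psi_1, ..., psi_n, kappa_1, delta^0_J (|J| >= 2) and delta_nonsep.
    A relation L = R between these classes is the vector L - R. *)
Definition bigset (n : nat) : finType := {J : {set 'I_n} | (1 < #|J|)%N}.

Definition divgen (n : nat) : finType := ('I_n + bigset n + bool)%type.

Definition divspace (n : nat) : vectType rat := {ffun divgen n -> rat^o}.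

Definition gen_vec n (x : divgen n) : divspace n := [ffun y => (y == x)%:R].

Definition psi n (i : 'I_n) : divspace n := gen_vec (inl (inl i)).
Definition kappa1 n : divspace n := gen_vec (inr false).
Definition delta_nonsep n : divspace n := gen_vec (inr true).

(** Set to 0 if J has fewer than two elements. *)
Definition delta0 n (J : {set 'I_n}) : divspace n :=
  if insub J is Some J' then gen_vec (inl (inr J')) else 0.

(** The class of a decorated stable graph of genus 1 and codimension 1.  For a
    graph with one edge the gluing map has degree |Aut G| onto the boundary
    divisor, whence the factor |Aut G|. *)
Definition div_class n (X : decgraph n) : divspace n :=
  if codim X != 1%N then 0
  else if dg_nedge X == 0%N then
    \sum_i (dg_psi_leg X i)%:R *: psi i
    + (\sum_u count_mem 1%N (dg_kappa X u))%N%:R *: kappa1 n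
  else
    #|graph_aut (dg_graph X)|%:R *:
      (if dg_nvert X == 1%N then delta_nonsep n
       else delta0 [set i | vgenus (dg_graph X) (leg (dg_graph X) i) == 0%N]).

(** * The relations generated by the PPZ relations

    The map x |-> pi_*(psi_(n+1) x) from the divisors on Mbar_(1,n+1) to those
    on Mbar_(1,n), where pi forgets the last marking.  The class psi_(n+1) has
    degree 2h - 2 + l on the fibre of the map forgetting a leg of a vertex of
    genus h with l other half-edges, and
      psi_(n+1) psi_j = psi_(n+1) pi^* psi_j  (j <= n),
      pi_* psi_(n+1)^2 = kappa_1,
      kappa_1 = pi^* kappa_1 + psi_(n+1).
    In delta^0_J the vertex of the last leg has genus 0 and |J| other
    half-edges if the leg is in J, and genus 1 and n + 1 - |J| other half-edges
    if it is not; in delta_nonsep it has genus 0 and n + 2 others. *)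
Definition push_psi_gen n (x : divgen n.+1) : divspace n :=
  match x with
  | inl (inl i) => if unlift ord_max i is Some j then n%:R *: psi j else kappa1 n
  | inl (inr J) =>
      let J' := [set i : 'I_n | lift ord_max i \in val J] in
      (if ord_max \in val J then #|val J| - 2 else n.+1 - #|val J|)%N%:R
        *: delta0 J'
  | inr false => n.+1%:R *: kappa1 n
  | inr true => n%:R *: delta_nonsep n
  end.

Definition push_psi n (x : divspace n.+1) : divspace n :=
  \sum_(y : divgen n.+1) (x y : rat) *: push_psi_gen y.

(** The smallest system of subspaces of the spaces [divspace n], n >= 1, which
    contains the PPZ relations of genus 1 and degree 1 and is closed under
    multiplication by the psi class of a marking followed by push-forward along
    the map forgetting that marking.

    Linear combinations alone do not suffice: in genus 1 and degree 1,
    d < 0 forces sum a_i < r, and T vanishes identically unless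
    sum a_i = 1 mod r - 1.  So for each n only the n vectors a with a single
    entry 1 and all others 0 contribute. *)
Inductive ppz_generated (r : nat) : forall n : nat, divspace n -> Prop :=
| ppz_relation n (a : 'I_n -> 'I_r.-1) (d : int) :
    (0 < n)%N -> d < 0 ->
    d * (r%:Z - 1)
      = \sum_i (a i)%:Z + (1%N%:Z - 1) * (r%:Z - 2) - r%:Z * 1%N%:Z ->
    ppz_generated r (ppz 1 1 a d (@div_class n))
| ppz_zero n : (0 < n)%N -> ppz_generated r (0 : divspace n)
| ppz_linear n (c : rat) (x y : divspace n) :
    ppz_generated r x -> ppz_generated r y -> ppz_generated r (c *: x + y)
| ppz_push n (x : divspace n.+1) :
    (0 < n)%N -> ppz_generated r x -> ppz_generated r (push_psi x).

(** * The relations to be generated *)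
Definition psi_relation n (i : 'I_n) : divspace n :=
  12%:R *: psi i
  - (delta_nonsep n
     + 12%:R *: \sum_(J : {set 'I_n} | (i \in J) && (1 < #|J|)%N) delta0 J).

Definition kappa_relation n : divspace n :=
  kappa1 n
  - (\sum_(i < n) psi i - \sum_(J : {set 'I_n} | (1 < #|J|)%N) delta0 J).

Definition genus1_relations n : seq (divspace n) :=
  kappa_relation n :: [seq psi_relation i | i <- enum 'I_n].

(* Main.v *)
From HB Require Import structures.
Require Import Defs.
From mathcomp Require Import all_boot all_order all_algebra all_fingroup.
From mathcomp Require Import zify ring.

Set Implicit Arguments.
Unset Strict Implicit.
Unset Printing Implicit Defensive.

Import Order.TTheory GRing.Theory Num.Theory.

Local Open Scope ring_scope.

(** In genus 1 and degree 1 the degree equation reads [d (r - 1) = sum a_i - r],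
    and [d < 0] forces [d = -1] and [sum a_i = 1].  A class of codimension 1 is
    carried by very few graphs: a single vertex of genus 1 with one psi class
    (giving the psi_i) or with one extra leg (giving kappa_1), a vertex of
    genus 0 with a loop (giving delta_nonsep), and an edge from a vertex of
    genus 0 carrying the legs in [J] to a vertex of genus 1 (giving delta^0_J).
    Connectedness and the genus exclude everything else with at most one edge.
    On each of these graphs the divisibility conditions in the tensors leave
    one basis index at every leg and at every half-edge, up to the free index
    running around a loop.  With [P b] for [P_1(r, b)] and [a_J] for the sum of
    the [a_i] with [i] in [J], this gives
<<
      r T_a = sum_i P(a_i) psi_i - P(0) kappa_1 - sum_J P(a_J) delta^0_J
              - (1 / (r - 1)) (sum_(b < r - 1) P(b)) delta_nonsep.
>>
    All the arguments [a_i] and [a_J] are 0 or 1, where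
    [P b = (r - 2) / 24 * (12 b - (2 r - 1))] ([ppzP1_bit]), and the loop sum is
    [(r - 1)(r - 2) / 24] ([sum_ppzP1]).  Write [K_n] for [kappa_relation n] and
    [Psi_i] for [psi_relation i].  The formula becomes ([ppz_genus1E])
<<
      r T_a = (r - 2) / 24 * ((2 r - 1) K_n + sum_i a_i Psi_i).
>>
    Hence every PPZ relation lies in the span of [K_n] and the [Psi_i].

    The operation x |-> pi_*(psi_(n+1) x) acts on this span by
<<
      K_(n+1) |-> n K_n,   Psi_i |-> n Psi_i  (i <= n),
      Psi_(n+1) |-> 12 K_n + sum_(i <= n) Psi_i,
>>
    so everything that is generated stays in the span ([push_psi_span]).
    Conversely put [Y_(n,p) = (2 r - 1) K_n + Psi_p], which is generated because
    [r > 2] makes the factor [(r - 2) / 24] invertible.  The image of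
    [Y_(n+1,n+1)] is [12 K_n + sum_p Y_(n,p)], so [K_n] is generated
    ([kappa_relation_generated]), and then so is each [Psi_p]. *)

(** * The numbers P_1 *)

Lemma sum_linear_factor (R : rat) (a : nat) :
  \sum_(1 <= b < a.+1) (R - 2%:R * b%:R) = a%:R * (R - 1 - a%:R).
Proof.
elim: a => [|a IHa]; first by rewrite big_nil mul0r.
rewrite big_nat_recr //= IHa -[a.+1]addn1 natrD; ring.
Qed.

Lemma sum_cubic_factor (R : rat) (N : nat) :
  \sum_(1 <= b < N.+1) (R - 1 - b%:R) * (2%:R * R - b%:R) * (R - 2%:R * b%:R)
  = N%:R * (2%:R * R ^+ 2 * (R - 1)
      - (7%:R * R ^+ 2 - 5%:R * R) * (N%:R + 1) / 2%:R
      + (7%:R * R - 2%:R) * (N%:R + 1) * (2%:R * N%:R + 1) / 6%:R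
      - N%:R * (N%:R + 1) ^+ 2 / 2%:R).
Proof.
elim: N => [|N IHN]; first by rewrite big_nil mul0r.
rewrite big_nat_recr //= IHN -[N.+1]addn1 natrD; by field.
Qed.

(** The closed form [P_1(r, a) = a (r - 1 - a) / 2 - (2 r - 1)(r - 2) / 24]; its
    second term is [P_1(r, 0)]. *)
Lemma ppzP1 (r a : nat) : (2 < r)%N ->
  ppzP r 1 a = a%:R * (r%:R - 1 - a%:R) / 2%:R
               - (2%:R * r%:R - 1) * (r%:R - 2%:R) / 24%:R.
Proof.
move=> hr /=.
have -> : r.-1 = (r - 2).+1 by lia.
under eq_bigr do rewrite !mulr1.
rewrite -[in X in _ - X]/(ppzP r 0 0) /=.
under [X in _ - _ * X]eq_bigr do rewrite !mulr1.
have E b : 2%:R * r%:R - r%:R - 2%:R * b%:R = r%:R - 2%:R * b%:R :> rat by ring.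
under eq_bigr do rewrite E.
under [X in _ - _ * X]eq_bigr do rewrite E.
rewrite sum_linear_factor sum_cubic_factor natrB; last by lia.
have r0 : r%:R != 0 :> rat by rewrite pnatr_eq0; lia.
have r1 : r%:R - 1 != 0 :> rat by rewrite subr_eq0 pnatr_eq1; lia.
by field; rewrite r0 r1.
Qed.

(** For [b] = 0 or 1 the quadratic [b (r - 1 - b)] equals the linear [b (r - 2)].
    This linearity in [b] is what makes the PPZ relation a combination of
    [kappa_relation] and [psi_relation]. *)
Lemma ppzP1_bit (r b : nat) : (2 < r)%N -> (b < 2)%N ->
  ppzP r 1 b = (r%:R - 2%:R) / 24%:R * (12%:R * b%:R - (2%:R * r%:R - 1)).
Proof.
by move=> hr; case: b => [|[|//]] _; rewrite ppzP1 //; field.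
Qed.

Lemma sum_ppzP1 (r : nat) : (2 < r)%N ->
  \sum_(j < r.-1) ppzP r 1 j = (r%:R - 1) * (r%:R - 2%:R) / 24%:R.
Proof.
move=> hr.
have aux (R : rat) N : \sum_(j < N) (j%:R * (R - 1 - j%:R) / 2%:R
               - (2%:R * R - 1) * (R - 2%:R) / 24%:R)
   = N%:R * ((N%:R - 1) * (R - 1) / 4%:R - (N%:R - 1) * (2%:R * N%:R - 1) / 12%:R
     - (2%:R * R - 1) * (R - 2%:R) / 24%:R).
  elim: N => [|N IHN]; first by rewrite big_ord0 mul0r.
  by rewrite big_ord_recr /= IHN -[N.+1]addn1 natrD; field.
under eq_bigr do rewrite ppzP1 //.
rewrite aux -subn1 natrB; last by lia.
by field.
Qed.

(** * Push-forward of the relations along a forgetful map *)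

Lemma mem_lift_max n (K : {set 'I_n}) i :
  (lift ord_max i \in lift ord_max @: K) = (i \in K).
Proof. by rewrite mem_imset //; apply: lift_inj. Qed.

Lemma max_notin_lift n (K : {set 'I_n}) : ord_max \in lift ord_max @: K = false.
Proof. by apply/imsetP => -[i _ /eqP]; rewrite (negbTE (neq_lift _ _)). Qed.

Lemma mem_max_lift n (K : {set 'I_n}) i :
  (lift ord_max i \in ord_max |: lift ord_max @: K) = (i \in K).
Proof. by rewrite in_setU1 mem_lift_max eq_sym (negbTE (neq_lift _ _)). Qed.

Lemma big_set_ordS (V : nmodType) n (F : {set 'I_n.+1} -> V) :
  \sum_J F J = \sum_(K : {set 'I_n}) F (lift ord_max @: K)
             + \sum_(K : {set 'I_n}) F (ord_max |: lift ord_max @: K).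
Proof.
rewrite (bigID (fun J : {set 'I_n.+1} => ord_max \in J)) /= addrC.
congr (_ + _).
- rewrite (reindex_onto (fun K : {set 'I_n} => lift ord_max @: K)
            (fun J : {set 'I_n.+1} => [set i | lift ord_max i \in J])) /=.
    apply: eq_bigl => K; rewrite max_notin_lift /=; apply/eqP/setP => i.
    by rewrite inE mem_lift_max.
  move=> J Jmax; apply/setP => j.
  case: (unliftP ord_max j) => [i|] ->; first by rewrite mem_lift_max inE.
  by rewrite max_notin_lift (negbTE Jmax).
rewrite (reindex_onto (fun K : {set 'I_n} => ord_max |: lift ord_max @: K)
            (fun J : {set 'I_n.+1} => [set i | lift ord_max i \in J])) /=.
  apply: eq_bigl => K; rewrite setU11 /=; apply/eqP/setP => i.
  by rewrite inE mem_max_lift.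
move=> J Jmax; apply/setP => j.
case: (unliftP ord_max j) => [i|] ->; first by rewrite mem_max_lift inE.
by rewrite setU11 Jmax.
Qed.

Lemma push_psi_is_linear n : linear (@push_psi n).
Proof.
move=> c x y; rewrite /push_psi scaler_sumr -big_split /=.
by apply: eq_bigr => z _; rewrite !ffunE scalerDl scalerA.
Qed.

HB.instance Definition _ n :=
  GRing.isLinear.Build rat (divspace n.+1) (divspace n) *:%R (@push_psi n)
    (@push_psi_is_linear n).

Arguments push_psi : simpl never.

Lemma push_psiD n (x y : divspace n.+1) :
  push_psi (x + y) = push_psi x + push_psi y.
Proof. exact: (linearD (@push_psi n)). Qed.

Lemma push_psiB n (x y : divspace n.+1) :
  push_psi (x - y) = push_psi x - push_psi y.
Proof. exact: (linearB (@push_psi n)). Qed.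

Lemma push_psiZ n (c : rat) (x : divspace n.+1) :
  push_psi (c *: x) = c *: push_psi x.
Proof. exact: (linearZ_LR (@push_psi n)). Qed.

Lemma push_psi_gen_vec n (y : divgen n.+1) :
  push_psi (gen_vec y) = push_psi_gen y.
Proof.
rewrite /push_psi (bigD1 y) //= ffunE eqxx scale1r big1 ?addr0 // => z zy.
by rewrite ffunE (negbTE zy) scale0r.
Qed.

Lemma delta0_gen n (J : {set 'I_n}) (hJ : (1 < #|J|)%N) :
  delta0 J = gen_vec (inl (inr (Sub J hJ : bigset n))).
Proof. by rewrite /delta0 insubT. Qed.

Lemma delta0_small n (J : {set 'I_n}) : (#|J| <= 1)%N -> delta0 J = 0.
Proof. by move=> hJ; rewrite /delta0 insubF // ltnNge hJ. Qed.

Lemma push_delta0 n (J : {set 'I_n.+1}) : (1 < #|J|)%N ->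
  push_psi (delta0 J) =
  (if ord_max \in J then #|J| - 2 else n.+1 - #|J|)%N%:R
    *: delta0 [set i : 'I_n | lift ord_max i \in J].
Proof. by move=> hJ; rewrite delta0_gen push_psi_gen_vec. Qed.

(** A subset [K] of the first [n] markings is the trace of two subsets, [K] and
    [K] with the new marking; these give the two terms. *)
Lemma push_delta0_sum n (c : {set 'I_n.+1} -> rat) :
  push_psi (\sum_J c J *: delta0 J) =
  \sum_(K : {set 'I_n})
    ((n.+1 - #|K|)%N%:R * c (lift ord_max @: K)
     + (#|K| - 1)%N%:R * c (ord_max |: lift ord_max @: K)) *: delta0 K.
Proof.
have cardK (K : {set 'I_n}) : #|lift ord_max @: K| = #|K|.
  by rewrite card_imset //; apply: lift_inj.
rewrite linear_sum /= big_set_ordS -big_split /=; apply: eq_bigr => K _.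
rewrite !push_psiZ.
have E1 : push_psi (delta0 (lift ord_max @: K)) = (n.+1 - #|K|)%N%:R *: delta0 K.
  have [hK|hK] := ltnP 1 #|K|; last first.
    by rewrite !delta0_small ?cardK // linear0 scaler0.
  rewrite push_delta0 cardK // max_notin_lift; congr (_ *: delta0 _).
  by apply/setP => i; rewrite inE mem_lift_max.
have E2 : push_psi (delta0 (ord_max |: lift ord_max @: K)) = (#|K| - 1)%N%:R *: delta0 K.
  have cU : #|ord_max |: lift ord_max @: K| = #|K|.+1 by rewrite cardsU1 max_notin_lift cardK.
  have [hK|hK] := ltnP 0 #|K|; last first.
    by rewrite !delta0_small ?cU ?linear0 ?scaler0 //; lia.
  rewrite push_delta0 cU // setU11 subSS; congr (_ *: delta0 _).
  by apply/setP => i; rewrite inE mem_max_lift.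
by rewrite E1 E2 !scalerA -scalerDl; congr (_ *: _); ring.
Qed.

(** Summing over all subsets with weights, as [delta0] is zero on the small ones,
    lets [push_delta0_sum] apply without side conditions. *)
Lemma kappa_relationE n :
  kappa_relation n = kappa1 n - \sum_(i < n) psi i
                     + \sum_(J : {set 'I_n}) 1 *: delta0 J.
Proof.
rewrite /kappa_relation opprB addrA addrAC.
rewrite [in RHS](bigID (fun J : {set 'I_n} => (1 < #|J|)%N)) /=.
rewrite [X in _ + (_ + X)]big1 ?addr0; last first.
  by move=> J; rewrite -leqNgt => hJ; rewrite delta0_small ?scaler0.
by congr (_ + _); apply: eq_bigr => J _; rewrite scale1r.
Qed.

Lemma psi_relationE n (i : 'I_n) :
  psi_relation i = 12%:R *: psi i - delta_nonsep n
    - 12%:R *: \sum_(J : {set 'I_n}) (i \in J)%:R *: delta0 J.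
Proof.
rewrite /psi_relation opprD addrA; congr (_ - _ *: _).
rewrite [RHS](bigID (fun J : {set 'I_n} => (i \in J) && (1 < #|J|)%N)) /=.
rewrite [X in (_ + X)]big1 ?addr0.
  by apply: eq_bigr => J /andP[-> _]; rewrite scale1r.
move=> J; rewrite negb_and => /orP[/negbTE ->|]; first by rewrite scale0r.
by rewrite -leqNgt => hJ; rewrite delta0_small ?scaler0.
Qed.

Lemma push_psi_psi n (i : 'I_n) : push_psi (psi (lift ord_max i)) = n%:R *: psi i.
Proof. by rewrite push_psi_gen_vec /push_psi_gen liftK. Qed.

Lemma push_psi_psi_max n : push_psi (psi (@ord_max n)) = kappa1 n.
Proof. by rewrite push_psi_gen_vec /push_psi_gen unlift_none. Qed.

Lemma push_kappa1 n : push_psi (kappa1 n.+1) = n.+1%:R *: kappa1 n.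
Proof. exact: push_psi_gen_vec. Qed.

Lemma push_delta_nonsep n : push_psi (delta_nonsep n.+1) = n%:R *: delta_nonsep n.
Proof. exact: push_psi_gen_vec. Qed.

(** The degrees of psi_(n+1) on the two fibre components over a point of
    delta^0_K add up to [n], its degree on a generic fibre in genus 1. *)
Lemma push_multiplicity (c n : nat) : (1 < c)%N -> (c <= n)%N ->
  (n.+1 - c + (c - 1))%N = n.
Proof. lia. Qed.

Lemma push_kappa_relation n :
  push_psi (kappa_relation n.+1) = n%:R *: kappa_relation n.
Proof.
rewrite !kappa_relationE push_psiD push_psiB push_delta0_sum push_kappa1.
rewrite (linear_sum (@push_psi n)) big_ord_recr /= push_psi_psi_max.
have -> : \sum_(i < n) push_psi (psi (widen_ord (leqnSn n) i)) = n%:R *: \sum_(i < n) psi i.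
  rewrite scaler_sumr; apply: eq_bigr => i _; rewrite -push_psi_psi.
  by congr (push_psi (psi _)); apply: val_inj; rewrite /= /bump leqNgt ltn_ord.
rewrite scalerDr scalerBr [X in _ = _ + X]scaler_sumr.
congr (_ + _).
  by rewrite opprD addrA addrAC -natr1 scalerDl scale1r addrK.
apply: eq_bigr => K _; have [hK|hK] := ltnP 1 #|K|; last first.
  by rewrite delta0_small // !scaler0.
have hK' : (#|K| <= n)%N by rewrite -[leqRHS]card_ord max_card.
rewrite scalerA !mulr1 -natrD; congr (_%:R *: _).
exact: push_multiplicity.
Qed.

Lemma push_psi_relation n (i : 'I_n) :
  push_psi (psi_relation (lift ord_max i)) = n%:R *: psi_relation i.
Proof.
rewrite !psi_relationE !push_psiB !push_psiZ push_delta0_sum push_psi_psi push_delta_nonsep.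
rewrite !scalerBr ![in RHS]scalerA ![in LHS]scalerA mulrC.
congr (_ - _ - _); rewrite mulrC -scalerA; congr (_ *: _); rewrite scaler_sumr.
apply: eq_bigr => K _; have [hK|hK] := ltnP 1 #|K|; last first.
  by rewrite delta0_small // !scaler0.
have hK' : (#|K| <= n)%N by rewrite -[leqRHS]card_ord max_card.
rewrite scalerA mem_lift_max mem_max_lift -mulrDl -natrD.
congr (_%:R * _ *: _); exact: push_multiplicity.
Qed.

(** Here psi_(n+1) maps to kappa_1, and delta^0_K survives with coefficient
    [-12 (#|K| - 1)]: the part [-12 #|K|] comes from the sum of the
    [psi_relation i], as [K] occurs in those with [i] in [K], and the part [12]
    from [12 *: kappa_relation n]. *)
Lemma push_psi_relation_max n :
  push_psi (psi_relation (@ord_max n))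
  = 12%:R *: kappa_relation n + \sum_(i < n) psi_relation i.
Proof.
rewrite psi_relationE !push_psiB !push_psiZ push_delta0_sum push_psi_psi_max push_delta_nonsep.
have -> : \sum_(i < n) psi_relation i
    = 12%:R *: \sum_(i < n) psi i - n%:R *: delta_nonsep n
      - 12%:R *: \sum_(J : {set 'I_n}) #|J|%:R *: delta0 J.
  under eq_bigr do rewrite psi_relationE.
  rewrite !sumrB -!scaler_sumr sumr_const card_ord scaler_nat exchange_big /=.
  congr (_ - _ *: _); first by rewrite !scaler_nat.
  apply: eq_bigr => J _.
  rewrite -scaler_suml -natr_sum -sum1_card; congr (_%:R *: _).
  by rewrite [RHS]big_mkcond; apply: eq_bigr => i _; case: (i \in J).
rewrite kappa_relationE.
have -> : \sum_(K : {set 'I_n})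
    ((n.+1 - #|K|)%N%:R * (ord_max \in lift ord_max @: K)%:R
     + (#|K| - 1)%N%:R * (ord_max \in ord_max |: lift ord_max @: K)%:R) *: delta0 K
  = \sum_(K : {set 'I_n}) #|K|%:R *: delta0 K - \sum_(K : {set 'I_n}) 1 *: delta0 K.
  rewrite -sumrB; apply: eq_bigr => K _; have [hK|hK] := ltnP 1 #|K|; last first.
    by rewrite delta0_small // !scaler0 subrr.
  by rewrite max_notin_lift setU11 mulr0 add0r mulr1 -scalerBl natrB // ltnW.
move: (\sum_K _) (\sum_K _) (\sum_i _) => A B C.
by apply/ffunP => y; rewrite !ffunE; ring.
Qed.

(** * The tensors in degree at most one *)

(** The sum over all choices of basis vectors at the legs collapses, because the
    tensor at each leg is supported on a single basis vector. *)
Lemma sum_prod_single (I J : finType) (R : comPzSemiRingType)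
    (h : {ffun I -> J} -> R) (L : I -> J -> R) (f : I -> J) :
  (forall i j, j != f i -> L i j = 0) ->
  \sum_(b : {ffun I -> J}) h b * \prod_i L i (b i)
  = h (finfun f) * \prod_i L i (f i).
Proof.
move=> L0; rewrite (bigD1 (finfun f)) //= [X in _ + X]big1 ?addr0.
  by congr (_ * _); apply: eq_bigr => i _; rewrite ffunE.
move=> b bf; have [/forallP bE|/forallPn[i bi]] := boolP [forall i, b i == f i].
  by case/eqP: bf; apply/ffunP => i; rewrite ffunE; apply/eqP.
by rewrite (bigD1 i) //= L0 // mul0r mulr0.
Qed.

Arguments ppzP : simpl never.

Lemma omega0 (r s : nat) : omega r 0 s = (r.-1 %| s.+1)%:R.
Proof.
rewrite /omega expr0 (_ : 0%:Z - 1 - s%:Z = - s.+1%:Z); last by lia.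
by rewrite dvdzE abszN /=; case: ifP.
Qed.

Lemma omega1 (r s : nat) : omega r 1 s = (r.-1 %| s)%:R * (r%:R - 1).
Proof.
rewrite /omega expr1 (_ : 1%:Z - 1 - s%:Z = - s%:Z); last by lia.
by rewrite dvdzE abszN /=; case: ifP => _; rewrite ?mul1r ?mul0r.
Qed.

Lemma ord_pred_val (w : nat) (a : 'I_w) :
  val (ord_pred a) = (if a == 0 :> nat then w.-1 else a.-1)%N.
Proof.
rewrite /=; case: a => [[|a] ha] /=.
  by rewrite modn_small //; lia.
by rewrite modnDr modn_small //; lia.
Qed.

Section Tensors.
Variables (r : nat) (hr : (2 < r)%N).
Local Notation w := r.-1.

Lemma basis_size_gt0 : (0 < w)%N. Proof. lia. Qed.
Definition basis0 : 'I_w := Ordinal basis_size_gt0.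

(** The only index [b] with [b + m = a] modulo [r - 1], for [m] = 0 or 1: the
    support of the m-th leg coefficient. *)
Definition leg_basis (m : 'I_2) (a : 'I_w) : 'I_w :=
  if m == 0 :> nat then a else ord_pred a.

Lemma leg_basisP (m : 'I_2) (a b : 'I_w) : (b + m == a %[mod w]) = (b == leg_basis m a).
Proof.
rewrite /leg_basis; case: m => [[|[|//]] hm] /=.
  by rewrite addn0 !modn_small.
rewrite addn1 -[in RHS]val_eqE ord_pred_val (modn_small (ltn_ord a)) /=.
have := ltn_ord a; have := ltn_ord b.
have [bw|bw] := eqVneq b.+1 w.
  by move=> *; rewrite bw modnn; case: ifP => ?; lia.
by move=> *; rewrite modn_small; [case: ifP => ?; lia | lia].
Qed.

Lemma Rinv_leg_basis (m : 'I_2) (a b : 'I_w) :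
  Rinv r m b a =
  (b == leg_basis m a)%:R * (((r%:R * (r%:R - 1)) ^+ m)^-1 * ppzP r m a).
Proof. by rewrite /Rinv leg_basisP; case: eqP; rewrite ?mul1r ?mul0r. Qed.

Lemma leg_basis_mod (m : 'I_2) (a : 'I_w) : leg_basis m a + m = a %[mod w].
Proof. by apply/eqP; rewrite leg_basisP. Qed.

Lemma Rinv0E (a b : 'I_w) : Rinv r 0 b a = (b == a)%:R.
Proof. by rewrite (Rinv_leg_basis ord0) /leg_basis /= expr0 invr1 !mulr1. Qed.

Lemma Rinv1E (a b : 'I_w) :
  Rinv r 1 b a = (b == ord_pred a)%:R * ((r%:R * (r%:R - 1))^-1 * ppzP r 1 a).
Proof. by rewrite (Rinv_leg_basis ord_max) /leg_basis /= expr1. Qed.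

Lemma etaE (i j : 'I_w) : eta i j = (i == rev_ord j)%:R.
Proof.
rewrite /eta; congr (_%:R); congr nat_of_bool.
rewrite -val_eqE /=; have := ltn_ord i; have := ltn_ord j; lia.
Qed.

(** The constant term of the edge series is the coefficient of psi' in its
    numerator; [R_0] is the identity and [eta] pairs [j] with [r - 2 - j]. *)
Lemma edge_coef0E (i j : 'I_w) :
  edge_coef 0 0 i j =
  - ((i == ord_pred (rev_ord j))%:R
     * ((r%:R * (r%:R - 1))^-1 * ppzP r 1 (rev_ord j))).
Proof.
have -> : edge_coef 0 0 i j = edge_num 1 0 i j.
  by rewrite /edge_coef big_ord1 expr0 mul1r.
rewrite /edge_num mul0r sub0r; congr (- _).
rewrite exchange_big (bigD1 j) //= [X in _ + X]big1 ?addr0; last first.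
  by move=> j2 jj; rewrite big1 // => j1 _; rewrite Rinv0E eq_sym (negbTE jj) mulr0.
rewrite (bigD1 (rev_ord j)) //= [X in _ + X]big1 ?addr0; last first.
  by move=> j1 jj; rewrite etaE (negbTE jj) mulr0 mul0r.
rewrite etaE Rinv0E !eqxx !mulr1; exact: (Rinv1E (rev_ord j) i).
Qed.

(** This symmetry of [P_1] is the degree 1 part of the symplectic condition on
    [R]; it makes the edge term independent of the orientation of the edge. *)
Lemma ppzP1_sym (a : nat) : (0 < a < w)%N -> ppzP r 1 (w - a) = ppzP r 1 a.
Proof.
move=> ha; rewrite !ppzP1 // natrB; last by lia.
rewrite -subn1 natrB; last by lia.
by field.
Qed.

Lemma edge_coef0C (i j : 'I_w) : edge_coef 0 0 i j = edge_coef 0 0 j i.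
Proof.
rewrite !edge_coef0E; congr (- _).
have symE : (i == ord_pred (rev_ord j)) = (j == ord_pred (rev_ord i)).
  rewrite -!val_eqE !ord_pred_val /=.
  have := ltn_ord i; have := ltn_ord j => hj hi.
  by case: ifP => h1; case: ifP => h2; apply/eqP/eqP => h3; lia.
rewrite -symE; case: eqP => [->|_]; last by rewrite !mul0r.
congr (_ * (_ * _)).
have := ord_pred_val (rev_ord j); have := ltn_ord j.
rewrite [rev_ord (ord_pred _)]/= => hj /= ->.
case: eqP => h; first by rewrite h; congr ppzP; lia.
rewrite -ppzP1_sym; last by lia.
by congr ppzP; lia.
Qed.

Section Contract.
Variables (n k v e : nat) (a : 'I_n -> 'I_w) (G : lgraph 1 (n + k) v e).
Variables (m : {ffun 'I_(n + k) -> 'I_2}) (q : {ffun 'I_e * bool -> 'I_2}).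

(** The [k] forgotten legs carry the coefficients of [R^-1] with lower index 0. *)
Definition leg_label (i : 'I_(n + k)) : 'I_w :=
  match split i with inl j => a j | inr _ => basis0 end.

Lemma leg_label_lshift i : leg_label (lshift k i) = a i.
Proof. by rewrite /leg_label (unsplitK (inl i)). Qed.

Lemma leg_label_rshift i : leg_label (rshift n i) = basis0.
Proof. by rewrite /leg_label (unsplitK (inr i)). Qed.

(** With the indices at the legs determined, the contraction is a sum over the
    indices at the half-edges times the product of the leg coefficients. *)
Lemma contractionE :
  contraction a G m q =
  (\sum_(c : {ffun 'I_e * bool -> 'I_w})
     (\prod_u omega r (vgenus G u)
        (\sum_(i | leg G i == u) leg_basis (m i) (leg_label i)
         + \sum_(h | half_vertex G h == u) c h)%N)
     * \prod_(j < e) edge_coef (q (j, false)) (q (j, true))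
                               (c (j, false)) (c (j, true)))
  * ((\prod_(i < n) (((r%:R * (r%:R - 1)) ^+ m (lshift k i))^-1
                     * ppzP r (m (lshift k i)) (a i)))
     * \prod_(i < k)
         (if (0 < m (rshift n i))%N
          then - (((r%:R * (r%:R - 1)) ^+ m (rshift n i))^-1
                  * ppzP r (m (rshift n i)) 0)
          else 0)).
Proof.
pose L (i : 'I_(n + k)) (b : 'I_w) : rat :=
  match split i with
  | inl j => Rinv r (m i) b (a j)
  | inr _ => if (0 < m i)%N then - Rinv r (m i) b 0 else 0
  end.
pose h (b : {ffun 'I_(n + k) -> 'I_w}) :=
  \sum_(c : {ffun 'I_e * bool -> 'I_w})
     (\prod_u omega r (vgenus G u)
        (\sum_(i | leg G i == u) b i
         + \sum_(h | half_vertex G h == u) c h)%N)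
     * \prod_(j < e) edge_coef (q (j, false)) (q (j, true))
                               (c (j, false)) (c (j, true)).
pose f i := leg_basis (m i) (leg_label i).
have L0 i b : b != f i -> L i b = 0.
  rewrite /L /f /leg_label; case: (split i) => [j|_] /negbTE hb.
    by rewrite Rinv_leg_basis hb mul0r.
  by rewrite (Rinv_leg_basis _ basis0) hb mul0r oppr0 if_same.
transitivity (\sum_b h b * \prod_i L i (b i)).
  apply: eq_bigr => b _; rewrite /h mulr_suml; apply: eq_bigr => c _.
  rewrite big_split_ord /= [RHS]mulrAC; congr (_ * _).
  rewrite -[LHS]mulrA; congr (_ * _).
  by congr (_ * _); apply: eq_bigr => i _;
    rewrite /L ?(unsplitK (inl i)) ?(unsplitK (inr i)).
rewrite (sum_prod_single _ L0); congr (_ * _).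
  apply: eq_bigr => c _; congr (_ * _); apply: eq_bigr => u _.
  by congr (omega _ _ (_ + _)%N); apply: eq_bigr => i _; rewrite ffunE.
rewrite big_split_ord /=; congr (_ * _); apply: eq_bigr => i _.
  by rewrite /L /f (unsplitK (inl i)) leg_label_lshift Rinv_leg_basis eqxx mul1r.
rewrite /L /f (unsplitK (inr i)) leg_label_rshift; case: ifP => // _.
by rewrite (Rinv_leg_basis _ basis0) eqxx mul1r.
Qed.

Lemma leg_sum_mod (P : pred 'I_(n + k)) :
  (\sum_(i | P i) leg_basis (m i) (leg_label i) + \sum_(i | P i) m i
   = \sum_(i | P i) leg_label i %[mod w])%N.
Proof.
rewrite -big_split /= -modn_summ -[in RHS]modn_summ; congr (_ %% _)%N.
by apply: eq_bigr => i _; exact: leg_basis_mod.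
Qed.

End Contract.
End Tensors.

(** * Stable graphs of genus one with at most one edge *)

Section Graphs.
Variables (g N v e : nat).
Implicit Type G : lgraph g N v e.

Lemma lgraphP G G' : (forall u, vgenus G u = vgenus G' u) ->
  (forall i, leg G i = leg G' i) ->
  (forall h, half_vertex G h = half_vertex G' h) -> G = G'.
Proof.
case: G => [[f l] s]; case: G' => [[f' l'] s'] E1 E2 E3.
by congr (_, _, _); apply/ffunP => z; [apply: val_inj; exact: E1 | exact: E2 | exact: E3].
Qed.

Lemma opposite_neq (h : 'I_e * bool) : (opposite h == h) = false.
Proof. by case: h => j []; rewrite xpair_eqE andbF. Qed.

Lemma oppositeK : involutive (@opposite e).
Proof. by case=> j b; rewrite /opposite /= negbK. Qed.

Lemma graph_aut_gt0 G : (0 < #|graph_aut G|)%N.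
Proof.
apply/card_gt0P; exists 1%g; rewrite !inE; apply/andP; split.
  by apply/forallP => h; rewrite !perm1.
apply/eqP/lgraphP => z; rewrite /vgenus /leg /half_vertex /= !ffunE ?invg1 !perm1 //.
Qed.

Lemma half_edge_exists G u w : is_stable G -> u != w ->
  exists h, half_vertex G h = u.
Proof.
case/and4P => _ /forallP/(_ u)/forallP/(_ w)/connectP[[|y p] /= + ->]; first by rewrite eqxx.
by case/andP => /existsP[h /andP[/eqP <- _]] _ _; exists h.
Qed.

(** With two or more vertices, connectedness gives every vertex a half-edge. *)
Lemma stable_nvert G : is_stable G -> (v <= maxn 1 (e * 2))%N.
Proof.
move=> sG; rewrite leq_max; have [//|v1 /=] := leqP v 1.
have ex u : exists h, half_vertex G h == u.
  have [w uw] : exists w : 'I_v, u != w.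
    have v0 : (0 < v)%N by lia.
    have [u0|] := eqVneq u (Ordinal v0); last by exists (Ordinal v0).
    by exists (Ordinal v1); rewrite u0.
  by have [h <-] := half_edge_exists sG uw; exists h.
pose f u := xchoose (ex u).
have f_inj : injective f.
  by move=> u u' E; rewrite -(eqP (xchooseP (ex u))) -(eqP (xchooseP (ex u'))) -/(f u) E.
have := leq_card f f_inj.
by rewrite card_prod !card_ord card_bool.
Qed.

Lemma stable_nvert_gt0 G : is_stable G -> (0 < v)%N.
Proof. by case/and4P. Qed.

End Graphs.

Section OneVertex.
Variables (N e : nat).
Implicit Type G : lgraph 1 N 1 e.

Definition one_vertex (h : 'I_2) : lgraph 1 N 1 e :=
  ([ffun => h], [ffun => ord0], [ffun => ord0]).

Lemma valence_one_vertex G u : valence G u = (N + e * 2)%N.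
Proof.
rewrite /valence; congr addn.
  rewrite -[RHS]card_ord -cardsT; congr #|pred_of_set _|.
  by apply/setP => i; rewrite !inE [leg G i]ord1 [u]ord1 eqxx.
have -> : (e * 2)%N = #|{: 'I_e * bool}| by rewrite card_prod card_ord card_bool.
rewrite -cardsT; congr #|pred_of_set _|.
by apply/setP => i; rewrite !inE [half_vertex G i]ord1 [u]ord1 eqxx.
Qed.

Lemma stable_one_vertex (h : 'I_2) G : (0 < N)%N -> (h + e)%N = 1%N ->
  is_stable G = (G == one_vertex h).
Proof.
move=> N0 he; apply/and4P/eqP.
  case=> _ _; rewrite big_ord1 => /eqP Eg _.
  apply: lgraphP => [u|i|j]; rewrite /vgenus /leg /half_vertex /= !ffunE ?[RHS]ord1.
  - have Eh : vgenus G ord0 = h by lia.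
    by rewrite (ord1 u : u = ord0).
  - by rewrite [LHS]ord1.
  - by rewrite [LHS]ord1.
move=> ->; split=> //.
- by apply/forallP => u; apply/forallP => u'; rewrite [u]ord1 [u']ord1 connect0.
- by rewrite big_ord1 /vgenus /= ffunE; apply/eqP; lia.
by apply/forallP => u; rewrite valence_one_vertex /vgenus /= ffunE; lia.
Qed.

Lemma iso_class_one_vertex G : #|iso_class G| = 1%N.
Proof.
rewrite (_ : iso_class G = [set G]) ?cards1 //; apply/setP => G'; rewrite inE.
have E s : relabel s G = G.
  apply: lgraphP => z; rewrite /vgenus /leg /half_vertex /= !ffunE.
  - by congr (nat_of_ord (_ _)); rewrite [LHS]ord1 [RHS]ord1.
  - by rewrite [LHS]ord1 [RHS]ord1.
  - by rewrite [LHS]ord1 [RHS]ord1.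
apply/imsetP/eqP => [[s _ ->]//|->]; exists 1%g; last by rewrite E.
by rewrite inE; apply/forallP => h; rewrite !perm1.
Qed.

End OneVertex.

Lemma graph_aut_point N (G : lgraph 1 N 1 0) : #|graph_aut G| = 1%N.
Proof.
apply/eqP; rewrite eqn_leq graph_aut_gt0 andbT.
apply: (@leq_trans #|[set 1%g : {perm 'I_1} * {perm 'I_0 * bool}]|); last by rewrite cards1.
apply/subset_leq_card/subsetP => -[s t] _; rewrite inE; apply/eqP; congr (_, _).
  by apply/permP => u; rewrite [LHS]ord1 [RHS]ord1.
by apply/permP => -[[]].
Qed.

(** The index [n + 0] is not convertible to [n], so the identification of the
    legs before and after forgetting none of them has to be made explicit. *)
Section ForgetNoLeg.
Variables (g n v e : nat).
Implicit Type G : lgraph g (n + 0) v e.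

Lemma lshift0K : cancel (cast_ord (addn0 n)) (@lshift n 0).
Proof. by move=> i; apply: val_inj. Qed.

Lemma forget0_stable G : is_stable (forget_legs G) = is_stable G.
Proof.
have E u : valence (forget_legs G) u = valence G u.
  rewrite /valence; congr addn; rewrite -!sum1dep_card big_split_ord /= big_ord0 addn0.
  by apply: eq_bigl => i; rewrite {1}/leg ffunE.
by congr [&& _, _, _ & _]; apply: eq_forallb => u; rewrite E.
Qed.

Lemma leg_forget0 G i :
  leg (forget_legs G) (cast_ord (addn0 n) i) = leg G i.
Proof. by rewrite {1}/leg ffunE lshift0K. Qed.

Lemma leg_relabel g' n' v' e' s (G : lgraph g' n' v' e') i :
  leg (relabel s G) i = s.1 (leg G i).
Proof. by rewrite {1}/leg ffunE. Qed.

Lemma forget0_aut G : graph_aut (forget_legs G) = graph_aut G.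
Proof.
apply/setP => s; apply/setIdP/setIdP => -[sR /eqP E]; split=> //;
  apply/eqP/lgraphP => z.
- exact: (congr1 (fun H : lgraph g n v e => vgenus H z) E).
- have := congr1 (fun H : lgraph g n v e => leg H (cast_ord (addn0 n) z)) E.
  by rewrite !leg_relabel leg_forget0.
- exact: (congr1 (fun H : lgraph g n v e => half_vertex H z) E).
- exact: (congr1 (fun H : lgraph g (n + 0) v e => vgenus H z) E).
- have := congr1 (fun H : lgraph g (n + 0) v e => leg H (lshift 0 z)) E.
  by rewrite !leg_relabel [leg (forget_legs G) z]ffunE.
- exact: (congr1 (fun H : lgraph g (n + 0) v e => half_vertex H z) E).
Qed.

End ForgetNoLeg.

Lemma eq_rev_ord2 (x u : 'I_2) : (u == rev_ord x) = (u != x).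
Proof. by case: x => [[|[|//]] ?]; case: u => [[|[|//]] ?]. Qed.

Lemma eq_opposite (h h' : 'I_1 * bool) : (h' == opposite h) = (h' != h).
Proof.
case: h => i b; case: h' => j c; rewrite /opposite !xpair_eqE /=.
by rewrite [i]ord1 [j]ord1 !eqxx /=; case: b; case: c.
Qed.

Lemma big_ord2 (R : Type) (idx : R) (op : Monoid.com_law idx) (x : 'I_2)
    (F : 'I_2 -> R) :
  \big[op/idx]_u F u = op (F x) (F (rev_ord x)).
Proof.
rewrite (bigD1 x) //=; congr (op _ _).
rewrite (eq_bigl (pred1 (rev_ord x))) ?big_pred1_eq // => u.
by rewrite /= eq_rev_ord2.
Qed.

Section Separating.
Variable n : nat.
Implicit Types (J : {set 'I_n}) (x : 'I_2) (h : 'I_1 * bool).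

(** The labelled graph of delta^0_J in which [x] is the vertex of genus 1 and [h]
    the half-edge at [x].  Each isomorphism class consists of the four choices
    of [(x, h)]. *)
Definition sep_graph J x h : lgraph 1 (n + 0) 2 1 :=
  ([ffun u => if u == x then ord_max else ord0],
   [ffun i => if cast_ord (addn0 n) i \in J then rev_ord x else x],
   [ffun h' => if h' == h then x else rev_ord x]).

Lemma sep_genus J x h u : vgenus (sep_graph J x h) u = (u == x).
Proof. by rewrite /vgenus ffunE; case: eqP. Qed.

Lemma rev_ord2_neq x : (rev_ord x == x) = false.
Proof. by rewrite eq_sym eq_rev_ord2 eqxx. Qed.

Lemma sep_leg J x h i :
  (leg (sep_graph J x h) (lshift 0 i) == rev_ord x) = (i \in J).
Proof.
rewrite /leg ffunE (_ : cast_ord _ _ = i); last exact: val_inj.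
by case: (i \in J); rewrite ?eqxx // eq_sym rev_ord2_neq.
Qed.

Lemma sep_half J x h h' : (half_vertex (sep_graph J x h) h' == x) = (h' == h).
Proof. by rewrite /half_vertex ffunE; case: ifP; rewrite ?eqxx // rev_ord2_neq. Qed.

Lemma sep_graph_inj J x h J' x' h' :
  sep_graph J x h = sep_graph J' x' h' -> [/\ J = J', x = x' & h = h'].
Proof.
move=> E; have Ex : x = x'.
  have := congr1 (fun H => vgenus H x) E; rewrite !sep_genus eqxx.
  by case: eqP.
subst x'; split=> //.
  by apply/setP => i; rewrite -(sep_leg J x h) E sep_leg.
by apply/eqP; rewrite -(sep_half J' x h') -E sep_half.
Qed.

Lemma stable_sep_graph J x h : is_stable (sep_graph J x h) = (1 < #|J|)%N.
Proof.
have half1 : half_vertex (sep_graph J x h) h = x by apply/eqP; rewrite sep_half.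
have half0 : half_vertex (sep_graph J x h) (opposite h) = rev_ord x.
  by apply/eqP; rewrite eq_rev_ord2 sep_half opposite_neq.
have conn u w : connect (adjacent (sep_graph J x h)) u w.
  have [->|uw] := eqVneq u w; first exact: connect0.
  apply/connect1/existsP.
  have -> : w = rev_ord u by apply/eqP; rewrite eq_rev_ord2 eq_sym.
  have [->|ux] := eqVneq u x; first by exists h; rewrite half1 half0 !eqxx.
  have -> : u = rev_ord x by apply/eqP; rewrite eq_rev_ord2.
  by exists (opposite h); rewrite oppositeK half1 half0 rev_ordK !eqxx.
have val0 : valence (sep_graph J x h) (rev_ord x) = (#|J| + 1)%N.
  rewrite /valence; congr addn.
    rewrite -sum1dep_card big_split_ord /= big_ord0 addn0 -sum1_card.
    by apply: eq_bigl => i; rewrite sep_leg.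
  rewrite -[RHS](cards1 (opposite h)); congr #|pred_of_set _|; apply/setP => h'.
  by rewrite !inE eq_rev_ord2 sep_half eq_opposite.
have val1 : (0 < valence (sep_graph J x h) x)%N.
  rewrite /valence addn_gt0; apply/orP; right; apply/card_gt0P; exists h.
  by rewrite inE half1.
apply/and4P/idP => [[_ _ _ /forallP/(_ (rev_ord x))]|J1].
  by rewrite sep_genus rev_ord2_neq val0; lia.
split=> //.
- by apply/forallP => u; apply/forallP => w; exact: conn.
- by rewrite (big_ord2 _ x) !sep_genus rev_ord2_neq eqxx.
apply/forallP => u; rewrite sep_genus; have [->|ux] := eqVneq u x; first by lia.
have -> : u = rev_ord x by apply/eqP; rewrite eq_rev_ord2.
by rewrite val0; lia.
Qed.

(** The genera add up to 1, so exactly one vertex has genus 1; each of the two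
    vertices needs a half-edge, so the edge joins them. *)
Lemma stable_is_sep_graph (G : lgraph 1 (n + 0) 2 1) : is_stable G ->
  exists J x h, G = sep_graph J x h.
Proof.
move=> sG; have /and4P[_ _ /eqP gG _] := sG.
have [x gx] : exists x, vgenus G x = 1%N /\ vgenus G (rev_ord x) = 0%N.
  move: gG; rewrite (big_ord2 _ ord0) /=.
  move=> gG; have [g0|g0] : vgenus G ord0 = 0%N \/ vgenus G ord0 = 1%N by lia.
    by exists (rev_ord ord0); rewrite rev_ordK; lia.
  by exists ord0; lia.
have [h hx] : exists h, half_vertex G h = x.
  by apply: (half_edge_exists (w := rev_ord x) sG); rewrite eq_sym rev_ord2_neq.
have [h' hx'] : exists h, half_vertex G h = rev_ord x.
  by apply: (half_edge_exists (w := x) sG); rewrite rev_ord2_neq.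
exists [set i | leg G (lshift 0 i) != x], x, h; apply: lgraphP => [u|i|j].
- rewrite sep_genus; have [->|ux] := eqVneq u x; first by case: gx.
  have -> : u = rev_ord x by apply/eqP; rewrite eq_rev_ord2.
  by case: gx.
- rewrite [RHS]/leg ffunE inE lshift0K -eq_rev_ord2; case: ifP => [/eqP|] //.
  by rewrite eq_rev_ord2 => /negbFE/eqP.
rewrite [RHS]/half_vertex ffunE; have [->|jh] := eqVneq j h; first by [].
have -> : j = opposite h by apply/eqP; rewrite eq_opposite.
rewrite -hx'; congr (half_vertex G); apply/esym/eqP; rewrite eq_opposite.
by apply/eqP => E; have := rev_ord2_neq x; rewrite -hx' E hx eqxx.
Qed.

Lemma big_stable_sep (V : nmodType) (F : lgraph 1 (n + 0) 2 1 -> V) :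
  \sum_(G | is_stable G) F G
  = \sum_(J : {set 'I_n} | (1 < #|J|)%N) \sum_x \sum_h F (sep_graph J x h).
Proof.
pose f (p : {set 'I_n} * ('I_2 * ('I_1 * bool))) := sep_graph p.1 p.2.1 p.2.2.
have f_inj : injective f.
  by move=> [J [x h]] [J' [x' h']] /sep_graph_inj[/= -> -> ->].
pose big_J := [set p : {set 'I_n} * ('I_2 * ('I_1 * bool)) | (1 < #|p.1|)%N].
transitivity (\sum_(G in [set f p | p in big_J]) F G).
  apply: eq_bigl => G; apply/idP/imsetP => [sG|[[J [x h]] + ->]].
    have [J [x [h E]]] := stable_is_sep_graph sG.
    by exists (J, (x, h)) => //; rewrite inE /= -(stable_sep_graph J x h) -E.
  by rewrite inE /= stable_sep_graph.
rewrite big_imset /=; last by move=> p p' _ _; exact: f_inj.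
under [RHS]eq_bigr do rewrite pair_big /=.
by rewrite pair_big /=; apply: eq_bigl => p; rewrite inE andbT.
Qed.

Lemma tperm_opposite h h' :
  [forall k, tperm h h' (opposite k) == opposite (tperm h h' k)].
Proof.
apply/forallP => k.
have [->|hh] := eqVneq h' h; first by rewrite tperm1 !perm1.
have -> : h' = opposite h by apply/eqP; rewrite eq_opposite.
have [->|kh] := eqVneq k h; first by rewrite tpermR tpermL oppositeK.
have -> : k = opposite h by apply/eqP; rewrite eq_opposite.
by rewrite oppositeK tpermR tpermL.
Qed.

(** A relabeling moves [(x, h)], and transpositions act transitively on these
    pairs. *)
Lemma iso_class_sep_graph J x h : #|iso_class (sep_graph J x h)| = 4%N.
Proof.
have rel s : relabel s (sep_graph J x h) = sep_graph J (s.1 x) (s.2 h).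
  have revs u : s.1 (rev_ord u) = rev_ord (s.1 u).
    by apply/eqP; rewrite eq_rev_ord2 (inj_eq perm_inj) rev_ord2_neq.
  apply: lgraphP => z.
  - by rewrite sep_genus /vgenus /= !ffunE (canF_eq (permKV _)); case: eqP.
  - by rewrite /leg /= !ffunE /leg ffunE; case: ifP.
  - by rewrite /half_vertex /= !ffunE /half_vertex ffunE (canF_eq (permKV _)); case: ifP.
transitivity #|[set sep_graph J p.1 p.2 | p in [set: 'I_2 * ('I_1 * bool)]]|.
  congr #|pred_of_set _|; apply/setP => G; apply/imsetP/imsetP => [[s sR ->]|[[x' h'] _ ->]].
    by exists (s.1 x, s.2 h); rewrite ?inE ?rel.
  exists (tperm x x', tperm h h'); last by rewrite rel /= !tpermL.
  by rewrite inE tperm_opposite.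
rewrite card_imset; last by move=> [x1 h1] [x2 h2] /sep_graph_inj[_ /= -> ->].
by rewrite cardsT !card_prod !card_ord card_bool.
Qed.

End Separating.

(** * The contribution of each graph *)

(** Without edges and with a vertex of genus 1, the exponent of phi selects the
    psi monomials of degree 1. *)
Lemma phi_degree1 (r S : nat) : (0 < r)%N ->
  (1%:Z - r%:Z * S%:Z == -1 * (r%:Z - 1)) = (S == 1%N).
Proof.
move=> r0; apply/eqP/eqP => [h|->]; last by ring.
have /eqP : r%:Z * (S%:Z - 1) = 0 by rewrite mulrBr mulr1; lia.
by rewrite mulf_eq0 => /orP[]; lia.
Qed.

Definition single_psi (I : finType) (i : I) : {ffun I -> 'I_2} :=
  [ffun j => if j == i then ord_max else ord0].

Lemma single_psiE (I : finType) (i j : I) : single_psi i j = (j == i) :> nat.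
Proof. by rewrite ffunE; case: eqP. Qed.

Lemma big_single_psi (I : finType) (V : nmodType) (F : {ffun I -> 'I_2} -> V) :
  \sum_(m : {ffun I -> 'I_2} | (\sum_i m i == 1)%N) F m = \sum_i F (single_psi i).
Proof.
have inj : injective (@single_psi I).
  move=> i j /(congr1 (fun m : {ffun I -> 'I_2} => nat_of_ord (m i))).
  by rewrite !single_psiE eqxx; case: eqP.
transitivity (\sum_(m in [set single_psi i | i in [set: I]]) F m).
  apply: eq_bigl => m; apply/idP/imsetP => [/sum_nat_eq1[i [_ mi m0]]|[i _ ->]].
    exists i => //; apply/ffunP => j; apply: ord_inj; rewrite single_psiE.
    by have [->|ji] := eqVneq j i; [exact: mi | exact: m0].
  rewrite (bigD1 i) //= big1 ?single_psiE ?eqxx // => j /negbTE ji.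
  by rewrite single_psiE ji.
rewrite big_imset /=; last by move=> i j _ _; exact: inj.
by apply: eq_bigl => i; rewrite inE.
Qed.

Lemma porbits_ord0 (s : {perm 'I_0}) : enum (porbits s) = [::].
Proof.
rewrite (_ : porbits s = set0) ?enum_set0 //.
by apply/setP => C; rewrite inE; apply/imsetP => -[[]].
Qed.

Lemma porbits_ord1 (s : {perm 'I_1}) : enum (porbits s) = [:: setT].
Proof.
rewrite (_ : porbits s = [set setT]) ?enum_set1 //.
have E x : porbit s x = setT.
  by apply/setP => y; rewrite inE [x]ord1 [y]ord1 porbit_id.
apply/setP => C; rewrite inE; apply/imsetP/eqP => [[x _ ->]//|->].
by exists ord0; rewrite ?E.
Qed.

Section Push.
Variables (n v e : nat).

(** One edge already has codimension 1, so no psi class may remain.  The factor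
    [#|graph_aut G|] is the degree of the gluing map. *)
Lemma push_forget_edges k (G : lgraph 1 (n + k) v e) m q :
  (1 < e)%N -> push_forget (D := 1) G m q (@div_class n) = 0.
Proof.
move=> e1; rewrite /push_forget; case: ifP => // _; apply: big1 => s _.
by rewrite /div_class ifT // /codim /=; lia.
Qed.

(** The forgotten leg contributes a kappa class of positive degree, which
    together with the edge makes the codimension at least 2. *)
Lemma push_forget1_edges (G : lgraph 1 (n + 1) v e)
    (m : {ffun 'I_(n + 1) -> 'I_2}) q :
  (0 < e)%N -> (0 < m (rshift n ord0))%N ->
  push_forget (D := 1) G m q (@div_class n) = 0.
Proof.
move=> e0 m0; rewrite /push_forget; case: ifP => // _; apply: big1 => s _.
rewrite /div_class ifT // /codim /=.
set K := (\sum_u sumn _)%N.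
suff : (0 < K)%N by lia.
rewrite /K (bigD1 (leg G (rshift n ord0))) //= porbits_ord1 /= ifT; last first.
  by apply/forallP => i; apply/implyP => _; rewrite (ord1 i : i = ord0).
by rewrite addn_gt0 /= addn0 (bigD1 ord0) ?inE //= addn_gt0 m0.
Qed.

End Push.

Section GraphSums.
Variables (r n : nat) (hr : (2 < r)%N) (hn : (0 < n)%N).
Local Notation w := r.-1.
Variable a : 'I_n -> 'I_w.
Hypothesis a1 : (\sum_i a i = 1)%N.
Let R : rat := r%:R.

(** The part of the PPZ class coming from graphs with [k] forgotten legs, [v]
    vertices and [e] edges, for [g = D = 1] and [d = -1]. *)
Definition graph_sum k v e : divspace n :=
  \sum_(G : lgraph 1 (n + k) v e | is_stable G)
  ((#|iso_class G|%:R * #|graph_aut G|%:R) : rat)^-1 *: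
  \sum_(m : {ffun 'I_(n + k) -> 'I_2})
  \sum_(q : {ffun 'I_e * bool -> 'I_2} |
          phi_exponent a G m q == -1 * (r%:Z - 1))
    contraction a G m q *: push_forget G m q (@div_class n).

Lemma r_neq0 : R != 0. Proof. by rewrite pnatr_eq0; lia. Qed.
Lemma r1_neq0 : R - 1 != 0. Proof. by rewrite subr_eq0 pnatr_eq1; lia. Qed.

Let no_psi_point : {ffun 'I_0 * bool -> 'I_2} := [ffun => ord0].

Lemma sum_point k v (G : lgraph 1 (n + k) v 0)
    (F : {ffun 'I_(n + k) -> 'I_2} -> _ -> divspace n) :
  (forall u, vgenus G u = 1%N) ->
  \sum_m \sum_(q : {ffun 'I_0 * bool -> 'I_2} |
              phi_exponent a G m q == -1 * (r%:Z - 1)) F m q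
  = \sum_i F (single_psi i) no_psi_point.
Proof.
move=> G1; rewrite -(big_single_psi (F^~ no_psi_point)) [RHS]big_mkcond /=.
apply: eq_bigr => m _.
have nq q : q = no_psi_point by apply/ffunP => -[[]].
rewrite big_mkcond (bigD1 no_psi_point) //= [X in _ + X]big1 ?addr0; last first.
  by move=> q; rewrite (nq q) eqxx.
congr (if _ then _ else _); rewrite /phi_exponent big_ord0 addr0.
rewrite big1 ?add0r; last by move=> u _; rewrite G1 subrr mul0r.
rewrite -!(big_morph Posz PoszD (erefl _)) a1.
by rewrite phi_degree1 //; lia.
Qed.

Local Notation scal m x :=
  (((r%:R * (r%:R - 1)) ^+ m)^-1 * ppzP r m x : rat).

Lemma scal0 x : scal 0 x = 1.
Proof. by rewrite expr0 invr1 mulr1. Qed.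

Lemma sum_leg_label k : (\sum_(i < n + k) leg_label hr a i = 1)%N.
Proof.
rewrite big_split_ord /= [X in (_ + X)%N]big1 => [|i _]; last by rewrite leg_label_rshift.
by rewrite addn0 -[RHS]a1; apply: eq_bigr => i _; rewrite leg_label_lshift.
Qed.

(** The indices at the legs add up to [sum a_i - 1 = 0] modulo [r - 1], so the
    genus 1 vertex contributes [r - 1]. *)
Lemma contraction_point k (m : {ffun 'I_(n + k) -> 'I_2}) q :
  (\sum_i m i)%N = 1%N ->
  contraction a (one_vertex (n + k) 0 ord_max) m q =
  (R - 1) * ((\prod_(i < n) scal (m (lshift k i)) (a i))
    * \prod_(i < k) (if (0 < m (rshift n i))%N
                     then - scal (m (rshift n i)) 0 else 0)).
Proof.
move=> m1; rewrite (contractionE hr); congr (_ * _).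
have nc c : c = [ffun => basis0 hr] :> {ffun 'I_0 * bool -> 'I_w} by apply/ffunP => -[[]].
rewrite (bigD1 [ffun => basis0 hr]) //= [X in _ + X]big1 ?addr0; last first.
  by move=> c; rewrite (nc c) eqxx.
rewrite big_ord1 big_ord0 mulr1 [vgenus _ _]/vgenus /= ffunE omega1.
have onlyP i : (leg (one_vertex (n + k) 0 ord_max) i == ord0) by rewrite /leg ffunE.
rewrite [X in (_ + X)%N]big1 => [|[[]]//]; rewrite addn0.
have := leg_sum_mod hr a m predT.
rewrite m1 sum_leg_label => /eqP.
rewrite -[X in _ == X %[mod _]]add0n eqn_modDr mod0n => E.
rewrite (eq_bigl predT) => [|i]; last exact: onlyP.
by rewrite /dvdn E mul1r.
Qed.

Lemma prod_scal_single k (i0 : 'I_n) :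
  \prod_(i < n) scal (single_psi (lshift k i0) (lshift k i)) (a i) = scal 1 (a i0).
Proof.
rewrite (bigD1 i0) //= big1 ?mulr1 ?single_psiE ?eqxx // => i /negbTE ii.
by rewrite single_psiE (inj_eq (@lshift_inj _ _)) ii scal0.
Qed.

Lemma prod_scal_last :
  \prod_(i < n) scal (single_psi (rshift n (ord0 : 'I_1)) (lshift 1 i)) (a i) = 1.
Proof. by apply: big1 => i _; rewrite single_psiE eq_lrshift scal0. Qed.

Lemma push_forget0 v e (G : lgraph 1 (n + 0) v e) m q :
  is_stable G ->
  push_forget (D := 1) G m q (@div_class n)
  = div_class (DecGraph (forget_legs G) (fun i => m (lshift 0 i) : nat)
            (fun h => q h : nat) (fun=> [::])).
Proof.
move=> sG; rewrite /push_forget forget0_stable sG.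
rewrite (big_pred1 1%g) => [|s]; first by rewrite porbits_ord0.
by rewrite /=; apply/forallP/eqP => [_|_ []//]; apply/permP => -[].
Qed.

Lemma sum_single_psi_leg k (i0 : 'I_n) :
  (\sum_(i < n) single_psi (lshift k i0) (lshift k i) = 1)%N.
Proof.
rewrite (bigD1 i0) //= big1 ?single_psiE ?eqxx // => i /negbTE ii.
by rewrite single_psiE (inj_eq (@lshift_inj _ _)) ii.
Qed.

Lemma sum_single_psi (I : finType) (i : I) : (\sum_j single_psi i j = 1)%N.
Proof.
rewrite (bigD1 i) //= big1 ?single_psiE ?eqxx // => j /negbTE ji.
by rewrite single_psiE ji.
Qed.

Lemma big_stable_point k (V : nmodType) (F : lgraph 1 (n + k) 1 0 -> V) :
  \sum_(G | is_stable G) F G = F (one_vertex _ _ ord_max).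
Proof.
by apply: big_pred1 => G; rewrite (@stable_one_vertex _ _ ord_max) //; lia.
Qed.

Lemma graph_sum_point k : graph_sum k 1 0 =
  \sum_i contraction a (one_vertex (n + k) 0 ord_max) (single_psi i) no_psi_point
    *: push_forget (D := 1) (one_vertex (n + k) 0 ord_max)
         (single_psi i) no_psi_point (@div_class n).
Proof.
rewrite /graph_sum big_stable_point iso_class_one_vertex graph_aut_point.
rewrite mulr1 invr1 scale1r.
rewrite (sum_point (fun m q => contraction a _ m q
  *: push_forget (D := 1) _ m q (@div_class n))) // => u.
by rewrite /vgenus ffunE.
Qed.

Lemma graph_sum_psi : graph_sum 0 1 0 = \sum_i (R^-1 * ppzP r 1 (a i)) *: psi i.
Proof.
rewrite graph_sum_point big_split_ord /= big_ord0 addr0; apply: eq_bigr => i _.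
rewrite contraction_point ?sum_single_psi // prod_scal_single big_ord0.
rewrite push_forget0; last by rewrite (@stable_one_vertex _ _ ord_max) //; lia.
congr (_ *: _).
  by rewrite -/R expr1; field; rewrite r_neq0 r1_neq0.
rewrite /div_class /codim /= sum_single_psi_leg [X in (_ + X + _)%N]big1 => [|[[]]//].
rewrite !big_ord1 /= scale0r addr0 (bigD1 i) //= single_psiE eqxx.
rewrite scale1r big1 ?addr0 // => j /negbTE ji.
by rewrite single_psiE (inj_eq (@lshift_inj _ _)) ji scale0r.
Qed.

Lemma graph_sum_kappa : graph_sum 1 1 0 = - (R^-1 * ppzP r 1 0) *: kappa1 n.
Proof.
rewrite graph_sum_point big_split_ord /= big1 ?add0r => [|i _]; last first.
  rewrite contraction_point ?sum_single_psi // big_ord1 single_psiE eq_rlshift /=.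
  by rewrite !mulr0 scale0r.
rewrite big_ord1 contraction_point ?sum_single_psi // prod_scal_last.
rewrite big_ord1 single_psiE eqxx /=.
congr (_ *: _).
  by rewrite -/R expr1; field; rewrite r_neq0 r1_neq0.
rewrite /push_forget (@stable_one_vertex _ _ ord_max) //.
rewrite ifT; last first.
  by apply/eqP/lgraphP => // i; rewrite [LHS]ord1 [RHS]ord1.
rewrite (big_pred1 1%g) => [|s]; last first.
  rewrite /=; apply/forallP/eqP => [_|_ i].
    by apply/permP => i; rewrite [LHS]ord1 [RHS]ord1.
  by rewrite [leg _ _]ord1 [X in _ == X]ord1.
rewrite porbits_ord1 /div_class /codim /=.
have onlyP (u : 'I_1) : [forall i in [set: 'I_1],
    leg (one_vertex (n + 1) 0 ord_max) (rshift n i) == u].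
  by apply/forallP => i; apply/implyP => _; rewrite [leg _ _]ord1 [u]ord1.
have sum1 : (\sum_(i in [set: 'I_1])
    single_psi (rshift n (ord0 : 'I_1)) (rshift n i) = 1)%N.
  rewrite (eq_bigl predT) => [|i]; last by rewrite inE.
  by rewrite big_ord1 single_psiE eqxx.
rewrite !big_ord1 !onlyP /= sum1 [X in (_ + _ + X + _)%N]big1 => [|[[]]//].
rewrite [X in (_ + X + _ + _)%N]big1 => [|i _]; last by rewrite single_psiE eq_lrshift.
rewrite /= big1 => [|i _]; last by rewrite single_psiE eq_lrshift scale0r.
by rewrite add0r scale1r.
Qed.

Lemma sum_half_edges (I : finType) (V : nmodType) (F : I -> I -> V)
    (h : 'I_1 * bool) :
  \sum_(c : {ffun 'I_1 * bool -> I}) F (c h) (c (opposite h))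
  = \sum_i \sum_j F i j.
Proof.
rewrite pair_big /=.
rewrite (reindex (fun p : I * I => [ffun h' => if h' == h then p.1 else p.2])) /=.
  by apply: eq_bigr => p _; rewrite !ffunE opposite_neq eqxx.
exists (fun c : {ffun 'I_1 * bool -> I} => (c h, c (opposite h))) => [[i j] _|c _].
  by rewrite !ffunE opposite_neq eqxx.
apply/ffunP => h'; rewrite ffunE; have [->//|hh] := eqVneq h' h.
by congr (c _); apply/eqP; rewrite eq_sym eq_opposite.
Qed.

(** Indexing by [j], the index paired by [eta] with the index at the second
    half-edge. *)
Lemma sum_edge_coef0 (F : 'I_w -> 'I_w -> rat) :
  \sum_i \sum_j F i j * edge_coef 0 0 i j
  = - (R * (R - 1))^-1 * \sum_(j : 'I_w) F (ord_pred j) (rev_ord j) * ppzP r 1 j.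
Proof.
rewrite exchange_big (reindex_inj rev_ord_inj) mulr_sumr /=; apply: eq_bigr => j _.
rewrite (bigD1 (ord_pred j)) //= big1 ?addr0 => [|i /negbTE ij].
  by rewrite edge_coef0E // rev_ordK eqxx mul1r mulNr mulrN mulrCA.
by rewrite edge_coef0E // rev_ordK ij mul0r oppr0 mulr0.
Qed.

(** The two indices at a loop always add up to [-2] modulo [r - 1], and the labels
    at the legs to 1, so the genus 0 vertex puts no condition on the free
    index [j], and all values of [P_1] are summed. *)
Lemma loop_edge_sum (A : nat) : A = 1%N ->
  \sum_(i : 'I_w) \sum_(j : 'I_w) omega r 0 (A + (i + j)) * edge_coef 0 0 i j
  = - (R - 2%:R) / (24%:R * R).
Proof.
move=> ->; rewrite (sum_edge_coef0 (fun i j : 'I_w => omega r 0 (1 + (i + j)))).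
under eq_bigr => j _.
  rewrite omega0 (_ : (w %| _)%N) ?mul1r; last first.
    rewrite (ord_pred_val j : nat_of_ord (ord_pred j) = _); have := ltn_ord j => hj.
    (* at j = 0 the index before j is r - 2, not -1: the multiple of r - 1 is 2 *)
    by rewrite /=; case: ifP => h; apply/dvdnP; [exists 2%N | exists 1%N]; lia.
  over.
rewrite sum_ppzP1 // -/R; field.
by rewrite r_neq0 r1_neq0.
Qed.

(** The condition at the genus 1 vertex, where the labels at the legs have sum
    [A], forces [j = B]; the condition at the genus 0 vertex then holds. *)
Lemma sep_edge_sum (A B : nat) : (A + B = 1)%N ->
  \sum_(i : 'I_w) \sum_(j : 'I_w)
    omega r 1 (A + i) * omega r 0 (B + j) * edge_coef 0 0 i j
  = - (R^-1 * ppzP r 1 B).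
Proof.
move=> AB; rewrite (sum_edge_coef0
  (fun i j : 'I_w => omega r 1 (A + i) * omega r 0 (B + j))).
have Bw : (B < w)%N by lia.
have dvd1 (j : 'I_w) : (w %| A + ord_pred j)%N = (j == Ordinal Bw).
  rewrite (ord_pred_val j : nat_of_ord (ord_pred j) = _) -val_eqE.
  have := ltn_ord j => hj.
  apply/dvdnP/eqP => /= [[c]|->].
    by case: ifP => h; case: c => [|[|c]]; nia.
  by case: ifP => h; [exists 1%N | exists 0%N]; lia.
rewrite (bigD1 (Ordinal Bw)) // big1 ?addr0 => [|j /negbTE jB]; last first.
  by rewrite omega1 dvd1 jB !mul0r.
rewrite omega1 dvd1 eqxx mul1r omega0 (_ : (w %| _)%N); last first.
  by apply/dvdnP; exists 1%N; rewrite /=; lia.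
rewrite -/R mulr1 /= addr0; field.
by rewrite r_neq0 r1_neq0.
Qed.

Let no_psi_half : {ffun 'I_1 * bool -> 'I_2} := [ffun => ord0].
Let no_psi_leg : {ffun 'I_(n + 0) -> 'I_2} := [ffun => ord0].

(** The boundary divisor of a graph with one edge. *)
Definition edge_class v (G : lgraph 1 n v 1) : divspace n :=
  if v == 1%N then delta_nonsep n else delta0 [set i | vgenus G (leg G i) == 0%N].

Lemma push_forget_edge v (G : lgraph 1 (n + 0) v 1) m q : is_stable G ->
  push_forget (D := 1) G m q (@div_class n)
  = if (m == no_psi_leg) && (q == no_psi_half)
    then #|graph_aut G|%:R *: edge_class (forget_legs G) else 0.
Proof.
move=> sG; rewrite push_forget0 // /div_class /codim /=.
rewrite [X in (_ + X)%N]big1 // addn0 forget0_aut.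
have -> : (1 + \sum_(i < n) m (lshift 0 i) + \sum_h q h != 1)%N
    = ~~ ((m == no_psi_leg) && (q == no_psi_half)).
  congr negb; rewrite -addnA -[X in _ == X]addn0 eqn_add2l addn_eq0 !sum_nat_eq0.
  congr andb; apply/forallP/eqP => [z|->] /=.
  - apply/ffunP => i; apply: ord_inj; rewrite ffunE -(lshift0K i).
    exact/eqP/(z (cast_ord (addn0 n) i)).
  - by move=> i; rewrite ffunE.
  - by apply/ffunP => h; apply: ord_inj; rewrite ffunE; exact/eqP/(z h).
  by move=> i; rewrite ffunE.
by case: (_ && _).
Qed.

Lemma graph_sum_edge v :
  (forall G : lgraph 1 (n + 0) v 1, is_stable G ->
     \sum_u ((vgenus G u)%:Z - 1) = -1) ->
  graph_sum 0 v 1 = \sum_(G : lgraph 1 (n + 0) v 1 | is_stable G)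
   (#|iso_class G|%:R^-1 * contraction a G no_psi_leg no_psi_half)
     *: edge_class (forget_legs G).
Proof.
move=> genusG; apply: eq_bigr => G sG.
rewrite (bigD1 no_psi_leg) //= [X in _ + X]big1 ?addr0; last first.
  by move=> m mn; apply: big1 => q _; rewrite push_forget_edge // (negbTE mn) scaler0.
rewrite (bigD1 no_psi_half) /=; last first.
  rewrite /phi_exponent -mulr_suml genusG // big_ord1 !ffunE.
  rewrite -!(big_morph Posz PoszD (erefl _)) a1.
  rewrite (big1 _ _ (fun i => no_psi_leg i : nat)) => [|i _]; last by rewrite ffunE.
  by apply/eqP; rewrite /=; ring.
rewrite big1 ?addr0; last first.
  by move=> q /andP[_ qn]; rewrite push_forget_edge // (negbTE qn) andbF scaler0.
rewrite push_forget_edge // !eqxx /= !scalerA; congr (_ *: _).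
have := graph_aut_gt0 G; rewrite -(ltr0n rat) => /lt0r_neq0 aut0.
by rewrite invfM -!mulrA; congr (_ * _); rewrite mulrCA mulVf ?mulr1.
Qed.

Lemma contraction_edge v (G : lgraph 1 (n + 0) v 1) h :
  contraction a G no_psi_leg no_psi_half =
  \sum_(c : {ffun 'I_1 * bool -> 'I_w})
     (\prod_u omega r (vgenus G u)
        (\sum_(i | leg G (lshift 0 i) == u) a i
         + \sum_(h | half_vertex G h == u) c h)%N)
     * edge_coef 0 0 (c h) (c (opposite h)).
Proof.
rewrite (contractionE hr) big_ord0 mulr1.
rewrite [X in _ * X = _]big1 ?mulr1 => [|i _]; last by rewrite ffunE scal0.
apply: eq_bigr => c _; congr (_ * _).
  apply: eq_bigr => u _; congr (omega _ _ (_ + _)%N).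
  rewrite big_split_ord /= big_ord0 addn0; apply: eq_bigr => i _.
  by rewrite ffunE leg_label_lshift.
rewrite big_ord1 !ffunE (_ : h = (ord0, h.2)); last first.
  by case: h => j b; rewrite (ord1 j : j = ord0).
by case: h.2; rewrite /opposite //= (edge_coef0C hr).
Qed.

Lemma graph_sum_loop :
  graph_sum 0 1 1 = (- (R - 2%:R) / (24%:R * R)) *: delta_nonsep n.
Proof.
have n0 : (0 < n + 0)%N by lia.
rewrite graph_sum_edge => [|G]; last first.
  by rewrite (@stable_one_vertex _ _ ord0) // => /eqP ->; rewrite big_ord1 /vgenus ffunE.
rewrite (big_pred1 (one_vertex (n + 0) 1 ord0)) => [|G]; last first.
  by rewrite (@stable_one_vertex _ _ ord0).
rewrite iso_class_one_vertex invr1 mul1r /edge_class eqxx; congr (_ *: _).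
rewrite (contraction_edge _ (ord0, false)) -(loop_edge_sum a1).
rewrite -(sum_half_edges (fun i j : 'I_w =>
  omega r 0 (\sum_i a i + (i + j)) * edge_coef 0 0 i j) (ord0, false)).
apply: eq_bigr => c _; rewrite big_ord1 [vgenus _ _]/vgenus ffunE.
congr (omega r 0 (_ + _)%N * _).
  by apply: eq_bigl => i; rewrite [leg _ _]ord1.
rewrite (eq_bigl predT) => [|h]; last by rewrite [half_vertex _ _]ord1.
rewrite (bigD1 (ord0, false)) //= (big_pred1 (ord0, true)) // => -[i b].
by rewrite (ord1 i : i = ord0) !xpair_eqE eqxx /=; case: b.
Qed.

Lemma contraction_sep J x h :
  contraction a (sep_graph J x h) no_psi_leg no_psi_half
  = - (R^-1 * ppzP r 1 (\sum_(i in J) a i)).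
Proof.
rewrite (contraction_edge _ h).
have AB : (\sum_(i | i \notin J) a i + \sum_(i in J) a i = 1)%N.
  by rewrite -a1 [RHS](bigID (mem J)) /= addnC.
rewrite -(sep_edge_sum AB).
rewrite -(sum_half_edges (fun i j : 'I_w =>
  omega r 1 (\sum_(i | i \notin J) a i + i)
  * omega r 0 (\sum_(i in J) a i + j) * edge_coef 0 0 i j) h).
apply: eq_bigr => c _; rewrite (big_ord2 _ x) /= !sep_genus eqxx rev_ord2_neq.
congr (omega r 1 (_ + _)%N * omega r 0 (_ + _)%N * _).
- by apply: eq_bigl => i; rewrite -(sep_leg J x h) eq_rev_ord2 negbK.
- by apply: big_pred1 => h'; rewrite /= sep_half.
- by apply: eq_bigl => i; rewrite sep_leg.
by apply: big_pred1 => h'; rewrite /= eq_opposite eq_rev_ord2 sep_half.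
Qed.

Lemma edge_class_sep J x h : edge_class (forget_legs (sep_graph J x h)) = delta0 J.
Proof.
rewrite /edge_class /=; congr delta0; apply/setP => i; rewrite inE.
rewrite [leg (forget_legs _) i]ffunE -[vgenus _ _]/(vgenus (sep_graph J x h) _).
rewrite sep_genus eqb0 -eq_rev_ord2 sep_leg //.
Qed.

Lemma graph_sum_sep :
  graph_sum 0 2 1 =
  \sum_(J : {set 'I_n} | (1 < #|J|)%N) - (R^-1 * ppzP r 1 (\sum_(i in J) a i)) *: delta0 J.
Proof.
rewrite graph_sum_edge => [|G /and4P[_ _ /eqP gG _]]; last first.
  by move: gG; rewrite !big_ord_recl !big_ord0; lia.
rewrite big_stable_sep; apply: eq_bigr => J _.
set c := - (R^-1 * _).
transitivity (\sum_(x : 'I_2) \sum_(h : 'I_1 * bool) (4%:R^-1 * c) *: delta0 J).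
  apply: eq_bigr => x _; apply: eq_bigr => h _.
  by rewrite iso_class_sep_graph contraction_sep edge_class_sep.
rewrite !sumr_const !card_prod !card_ord card_bool -!mulrnA -scaler_nat scalerA mulrA.
by rewrite mulfV ?mul1r.
Qed.

End GraphSums.

(** * The relations and what they generate *)

Lemma sum_genus1_shapes (V : nmodType) (M N : nat) (f : nat -> nat -> V) :
  (2 < M)%N -> (1 < N)%N ->
  (forall v e, (v, e) \notin [:: (1, 0); (1, 1); (2, 1)]%N -> f v e = 0) ->
  \sum_(v < M) \sum_(e < N) f v e = f 1%N 0%N + f 1%N 1%N + f 2%N 1%N.
Proof.
case: M => [|[|[|M]]] // _; case: N => [|[|N]] // _ f0.
pose g v := \sum_(e < N.+2) f v e.
have gE v : g v = f v 0%N + f v 1%N.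
  rewrite /g !big_ord_recl big1 ?addr0 // => e _.
  by rewrite f0 // !inE !xpair_eqE /= !andbF.
transitivity (\sum_(v < M.+3) g v) => //.
rewrite !big_ord_recl big1 ?addr0 => [|v _].
  by rewrite /= !gE (f0 0%N 0%N) // (f0 0%N 1%N) // (f0 2%N 0%N) // !add0r.
by rewrite gE !f0 ?addr0.
Qed.

Lemma degree1_data (S d r : int) : 2 < r -> 0 <= S -> d < 0 ->
  d * (r - 1) = S - r -> d = -1 /\ S = 1.
Proof.
move=> r2 S0 d0 E.
have d1 : d = -1 by nia.
by split=> //; subst d; lia.
Qed.

Section Relation.
Variables (r n : nat) (hr : (2 < r)%N) (hn : (0 < n)%N).
Variable a : 'I_n -> 'I_r.-1.
Hypothesis a1 : (\sum_i a i = 1)%N.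

Lemma graph_sum_vanish k v e : (k < 2)%N ->
  (v, e) \notin [:: (1, 0); (1, 1); (2, 1)]%N -> graph_sum a k v e = 0.
Proof.
move=> k2 ve; rewrite /graph_sum; apply: big1 => G sG.
have v0 := stable_nvert_gt0 sG; have ve2 := stable_nvert sG.
have e2 : (1 < e)%N.
  by move: ve v0 ve2; rewrite !inE !xpair_eqE; case: e {G sG} => [|[|e]]; lia.
rewrite [X in _ *: X]big1 ?scaler0 // => m _; apply: big1 => q _.
by rewrite push_forget_edges // scaler0.
Qed.

(** For [k = 1], either the leg coefficient of the forgotten leg vanishes or
    [push_forget1_edges] applies. *)
Lemma graph_sum1_edge v : graph_sum a 1 v 1 = 0.
Proof.
rewrite /graph_sum; apply: big1 => G sG.
rewrite [X in _ *: X]big1 ?scaler0 // => m _; apply: big1 => q _.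
have [m0|m0] := ltnP 0 (m (rshift n ord0)); first by rewrite push_forget1_edges // scaler0.
by rewrite (contractionE hr) big_ord1 ltnNge m0 !mulr0 scale0r.
Qed.

Lemma ppz_graph_sum : ppz 1 1 a (-1) (@div_class n) =
  graph_sum a 0 1 0 + graph_sum a 0 1 1 + graph_sum a 0 2 1 + graph_sum a 1 1 0.
Proof.
transitivity (\sum_(k < 2) ((k`!)%:R : rat)^-1 *:
   \sum_(v < 2 * 1 + n + k) \sum_(e < 3 * 1 + n + k) graph_sum a k v e).
  by rewrite /ppz subrr expr0z scale1r.
rewrite big_ord_recl big_ord1 /= !fact0 !invr1 !scale1r.
rewrite !sum_genus1_shapes ?graph_sum1_edge ?addr0 //; try lia.
all: by move=> v e; exact: graph_sum_vanish.
Qed.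

Let R : rat := r%:R.

Lemma ppz_genus1E : ppz 1 1 a (-1) (@div_class n) =
  ((R - 2%:R) / (24%:R * R)) *:
    ((2%:R * R - 1) *: kappa_relation n + \sum_i (a i)%:R *: psi_relation i).
Proof.
rewrite ppz_graph_sum (graph_sum_psi hr hn a1) (graph_sum_loop hr hn a1).
rewrite (graph_sum_sep hr hn a1) (graph_sum_kappa hr hn a1) -/R.
pose rho : rat := (R - 2%:R) / (24%:R * R).
rewrite -[X in X *: (_ + _)]/rho.
have R0 : R != 0 by rewrite pnatr_eq0; lia.
have P1 b : (b < 2)%N -> R^-1 * ppzP r 1 b = rho * (12%:R * b%:R - (2%:R * R - 1)).
  by move=> hb; rewrite ppzP1_bit // /rho -/R; field.
have aJ (J : {set 'I_n}) : (\sum_(i in J) a i < 2)%N.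
  by rewrite ltnS -a1 [leqRHS](bigID (mem J)) /= leq_addr.
have -> : \sum_i (R^-1 * ppzP r 1 (a i)) *: psi i
  = rho *: (12%:R *: (\sum_i (a i)%:R *: psi i) - (2%:R * R - 1) *: \sum_i psi i).
  rewrite !scaler_sumr -sumrB scaler_sumr; apply: eq_bigr => i _.
  rewrite P1; last by have := aJ [set i]; rewrite big_set1.
  by rewrite (scalerA 12%:R) -scalerBl scalerA.
have -> : \sum_(J : {set 'I_n} | (1 < #|J|)%N)
     - (R^-1 * ppzP r 1 (\sum_(i in J) a i)) *: delta0 J
  = - rho *: (12%:R *: (\sum_(J : {set 'I_n}) (\sum_(i in J) a i)%:R *: delta0 J)
             - (2%:R * R - 1) *: \sum_(J : {set 'I_n}) 1 *: delta0 J).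
  rewrite [in LHS]big_mkcond !scaler_sumr -sumrB scaler_sumr; apply: eq_bigr => J _.
  case: ltnP => hJ; last by rewrite delta0_small // !scaler0 subrr scaler0.
  by rewrite P1 // !scalerA -scalerBl scalerA mulr1 mulNr.
have -> : \sum_i (a i)%:R *: psi_relation i
  = 12%:R *: (\sum_i (a i)%:R *: psi i) - delta_nonsep n
    - 12%:R *: \sum_(J : {set 'I_n}) (\sum_(i in J) a i)%:R *: delta0 J.
  under eq_bigr do rewrite psi_relationE !scalerBr.
  rewrite !sumrB; congr (_ - _ - _).
  - by rewrite scaler_sumr; apply: eq_bigr => i _; rewrite !scalerA mulrC.
  - by rewrite -scaler_suml -natr_sum a1 scale1r.
  rewrite scaler_sumr; under eq_bigr do rewrite !scaler_sumr.
  rewrite exchange_big /=; apply: eq_bigr => J _.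
  rewrite natr_sum scalerA mulr_sumr scaler_suml [RHS]big_mkcond; apply: eq_bigr => i _.
  by rewrite !scalerA; case: ifP; rewrite ?mulr1 ?mulr0 ?scale0r // mulrC.
rewrite P1 // kappa_relationE -/rho mulNr -/rho.
move: (\sum_i _) (\sum_i _) (\sum_J _) (\sum_J _) => A B C D.
have E (c S u v x y z t : rat) :
    c * (12%:R * u - (2%:R * S - 1) * v) + - c * x
    + - c * (12%:R * z - (2%:R * S - 1) * t) + - (c * (12%:R * 0%:R - (2%:R * S - 1))) * y
  = c * ((2%:R * S - 1) * (y - v + t) + (12%:R * u - x - 12%:R * z)) by ring.
by apply/ffunP => y; rewrite !ffunE; apply: E.
Qed.

End Relation.

Lemma push_psi_span n (x : divspace n.+1) :
  x \in <<genus1_relations n.+1>>%VS -> push_psi x \in <<genus1_relations n>>%VS.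
Proof.
move=> xX; have kn : kappa_relation n \in <<genus1_relations n>>%VS.
  by apply: memv_span; rewrite mem_head.
have pn i : psi_relation i \in <<genus1_relations n>>%VS.
  by apply: memv_span; rewrite in_cons map_f ?orbT // mem_enum.
have : push_psi x \in (linfun (@push_psi n) @: <<genus1_relations n.+1>>)%VS.
  by rewrite -[push_psi x](lfunE (@push_psi n)) memv_img.
rewrite limg_span; apply/subvP: (push_psi x); apply/span_subvP => _ /mapP[y yX ->].
rewrite lfunE /=; move: yX; rewrite in_cons => /predU1P[->|/mapP[i _ ->]].
  by rewrite push_kappa_relation memvZ.
case: (unliftP ord_max i) => [j|] ->; first by rewrite push_psi_relation memvZ.
by rewrite push_psi_relation_max memvD ?memvZ ?memv_suml.
Qed.

Section Generated.
Variables (r n : nat) (hr : (2 < r)%N) (hn : (0 < n)%N).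

Lemma ppz_generatedZ c (x : divspace n) : ppz_generated r x -> ppz_generated r (c *: x).
Proof. by move=> gx; rewrite -[_ *: _]addr0; apply: ppz_linear => //; apply: ppz_zero. Qed.

Lemma ppz_generatedD (x y : divspace n) :
  ppz_generated r x -> ppz_generated r y -> ppz_generated r (x + y).
Proof. by move=> gx gy; rewrite -[x]scale1r; apply: ppz_linear. Qed.

Lemma ppz_generated_sum (I : Type) (s : seq I) (P : pred I) (F : I -> divspace n) :
  (forall i, P i -> ppz_generated r (F i)) -> ppz_generated r (\sum_(i <- s | P i) F i).
Proof. by move=> gF; apply: big_ind => //; [apply: ppz_zero | exact: ppz_generatedD]. Qed.

End Generated.

(** Take for [a] the indicator function of [p]; its value 1 is an index because
    [r >= 3]. *)
Lemma ppz_relation_generated r n (p : 'I_n) : (2 < r)%N ->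
  ppz_generated r ((2%:R * r%:R - 1) *: kappa_relation n + psi_relation p).
Proof.
move=> hr; have hn : (0 < n)%N by apply: leq_ltn_trans (ltn_ord p).
have w0 : (0 < r.-1)%N by lia.
have w1 : (1 < r.-1)%N by lia.
pose a i := if i == p then Ordinal w1 else Ordinal w0.
have aE i : a i = (i == p) :> nat by rewrite /a; case: eqP.
have a1 : (\sum_i a i = 1)%N.
  by rewrite (bigD1 p) //= big1 ?aE ?eqxx // => i /negbTE ip; rewrite aE ip.
have : ppz_generated r (ppz 1 1 a (-1) (@div_class n)).
  apply: ppz_relation => //.
  by rewrite -(big_morph Posz PoszD (erefl _)) a1; ring.
rewrite (ppz_genus1E hr hn a1) => /(ppz_generatedZ hn ((r%:R - 2%:R) / (24%:R * r%:R))^-1).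
rewrite scalerA mulVf ?scale1r; last first.
  apply: mulf_neq0; first by rewrite subr_eq0 eqr_nat; lia.
  by rewrite invr_neq0 // mulf_neq0 // pnatr_eq0; lia.
rewrite (bigD1 p) //= aE eqxx scale1r big1 ?addr0 // => i /negbTE ip.
by rewrite aE ip scale0r.
Qed.

(** On [n] markings the PPZ relations span only [n] dimensions.  The missing one
    comes from [n + 1] markings, by pushing forward the relation attached to the
    forgotten marking. *)
Lemma kappa_relation_generated r n : (2 < r)%N -> (0 < n)%N ->
  ppz_generated r (kappa_relation n).
Proof.
move=> hr hn; pose y m (p : 'I_m) := (2%:R * r%:R - 1) *: kappa_relation m + psi_relation p.
have gy m p : ppz_generated r (@y m p) by exact: ppz_relation_generated.
have : ppz_generated r (12%:R^-1 *: (push_psi (y n.+1 ord_max) + (-1) *: \sum_p y n p)).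
  apply: ppz_generatedZ => //; apply: ppz_generatedD => //; first exact: ppz_push.
  by apply: ppz_generatedZ => //; apply: ppz_generated_sum.
congr (ppz_generated _ _).
rewrite /y push_psiD push_psiZ push_kappa_relation push_psi_relation_max.
have -> : \sum_(p < n) ((2%:R * r%:R - 1) *: kappa_relation n + psi_relation p)
    = n%:R *: ((2%:R * r%:R - 1) *: kappa_relation n) + \sum_(p < n) psi_relation p.
  by rewrite big_split sumr_const card_ord scaler_nat.
move: (\sum_p _) (kappa_relation n) => S K.
have E (c d s t : rat) :
    12%:R^-1 * (c * (d * s) + (12%:R * s + t) + (-1) * (d * (c * s) + t)) = s.
  by field.
by apply/ffunP => z; rewrite !ffunE; apply: E.
Qed.

Lemma psi_relation_generated r n (p : 'I_n) : (2 < r)%N ->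
  ppz_generated r (psi_relation p).
Proof.
move=> hr; have hn : (0 < n)%N by apply: leq_ltn_trans (ltn_ord p).
have -> : psi_relation p = (- (2%:R * r%:R - 1)) *: kappa_relation n
    + ((2%:R * r%:R - 1) *: kappa_relation n + psi_relation p).
  by rewrite scaleNr addKr.
by apply: ppz_linear; [exact: kappa_relation_generated | exact: ppz_relation_generated].
Qed.

Theorem proposition4p2 (n r : nat) (hn : (1 <= n)%N) (hr : (3 <= r)%N)
    (x : divspace n) :
  ppz_generated r x <-> x \in <<genus1_relations n>>%VS.
Proof.
split=> [|xX].
  elim=> {n hn x} [n a d n0 d0 dE|n n0|n c x y _ IHx _ IHy|n x n0 _ IHx].
  - have [d1 /eqP] : d = -1 /\ (\sum_i a i)%N%:Z = 1.
      apply: (@degree1_data _ _ r%:Z) => //.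
      by rewrite dE -(big_morph Posz PoszD (erefl _)); ring.
    rewrite eqz_nat d1 => /eqP a1; rewrite (ppz_genus1E hr n0 a1).
    rewrite memvZ // memvD ?memvZ ?memv_suml // => [|i _].
      by apply: memv_span; rewrite mem_head.
    by apply/memvZ/memv_span; rewrite in_cons map_f ?orbT // mem_enum.
  - exact: mem0v.
  - by rewrite memvD ?memvZ.
  exact: push_psi_span.
rewrite (coord_span (X := in_tuple (genus1_relations n)) xX).
apply: ppz_generated_sum => // i _; apply: ppz_generatedZ => //.
have : (in_tuple (genus1_relations n))`_i \in genus1_relations n by rewrite mem_nth.
rewrite [X in X \in _ -> _]/= in_cons => /predU1P[->|/mapP[p _ ->]].
  exact: kappa_relation_generated.
exact: psi_relation_generated.
Qed.
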